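(* Every forcibly polyhedral sequence is unigraphic. That is, if $s$ is a graphical sequence such that every realisation of $s$ is a polyhedron, then, up to isomorphism, there is exactly one graph with degree sequence $s$.
   Context: All graphs are finite, with no multiple edges or loops. The degree sequence of a graph with $p$ vertices is the list $d_1,\dots,d_p$ of the degrees of its vertices (the order of the terms is immaterial). A sequence $s$ of $p$ non-negative integers is graphical if there exists a graph with degree sequence $s$; any such graph is called a realisation of $s$. A graph is called a polyhedron (or polyhedral) if it is the $1$-skeleton of a (convex) polyhedral solid; equivalently, it is planar and $3$-connected (in particular, it has at least $4$ vertices). A graphical sequence $s$ is forcibly polyhedral if every realisation of $s$ is a polyhedron. A sequence $s$ is unigraphic if, up to isomorphism, there is exactly one graph realising $s$. *)

(* Defs.v *)
From mathcomp Require Import all_boot all_order all_algebra.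
From mathcomp Require Import all_classical all_reals all_analysis.

Set Implicit Arguments.
Unset Strict Implicit.
Unset Printing Implicit Defensive.

Import numFieldNormedType.Exports.

Local Open Scope ring_scope.
Local Open Scope classical_set_scope.

Record sgraph := SGraph {
  vertex :> finType;
  adj : rel vertex;
  adj_sym : symmetric adj;
  adj_irrefl : irreflexive adj }.

Definition degree (G : sgraph) (x : G) : nat := #|[pred y | adj x y]|.

Definition realises (G : sgraph) (s : seq nat) : Prop :=
  perm_eq [seq degree x | x : G] s.

Definition graphical (s : seq nat) : Prop := exists G : sgraph, realises G s.

Definition isomorphic (G H : sgraph) : Prop :=
  exists2 f : G -> H, bijective f & forall x y, adj (f x) (f y) = adj x y.

Definition unigraphic (s : seq nat) : Prop :=
  exists2 G : sgraph, realises G s &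
    forall H : sgraph, realises H s -> isomorphic H G.

Definition three_connected (G : sgraph) : Prop :=
  (3 < #|G|)%N /\
  forall (S : {set G}) (x y : G), (#|S| < 3)%N -> x \notin S -> y \notin S ->
    connect [rel u v | [&& adj u v, u \notin S & v \notin S]] x y.

Definition simple_arc (R : realType) (p q : R * R) (A : set (R * R)) : Prop :=
  exists f : R -> R * R,
    [/\ {within `[0, 1], continuous f},
        {in `[0, 1] &, injective f},
        f 0 = p, f 1 = q & A = f @` `[0, 1]].

(* [arc x y] is only meaningful when [adj x y]. By the last two conditions,
   distinct edges meet at most in the points of their common endpoints. *)
Definition planar (R : realType) (G : sgraph) : Prop :=
  exists (pos : G -> R * R) (arc : G -> G -> set (R * R)),
    [/\ injective pos,
        forall x y, adj x y ->
          simple_arc (pos x) (pos y) (arc x y) /\ arc x y = arc y x,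
        forall x y z, adj x y -> arc x y (pos z) -> z = x \/ z = y &
        forall x y z w, adj x y -> adj z w ->
          ~ (x = z /\ y = w) -> ~ (x = w /\ y = z) ->
          arc x y `&` arc z w `<=` range pos].

Definition polyhedral (R : realType) (G : sgraph) : Prop :=
  planar R G /\ three_connected G.

Definition forcibly_polyhedral (R : realType) (s : seq nat) : Prop :=
  graphical s /\ forall G : sgraph, realises G s -> polyhedral R G.

(* Main.v *)
Require Import Defs.
From mathcomp Require Import all_boot all_order all_algebra.
From mathcomp Require Import all_classical all_reals all_analysis.
From mathcomp Require Import zify lra.

Set Implicit Arguments.
Unset Strict Implicit.
Unset Printing Implicit Defensive.

(** Call a graph with the same degrees as a given one _bad_ if it contains the
    complete bipartite graph K33 as a subgraph or can be disconnected by removing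
    at most two vertices.  A bad graph is not polyhedral, so a forcibly
    polyhedral sequence has no bad realisation.  It turns out that this leaves
    only ten sequences, all with at most eight terms, and that each of them is
    unigraphic.

    That K33 is not planar ([planar_K33_free]) is proved by an invariant modulo
    two.  If two disjoint arcs are sampled finely enough, the difference of the two samples
    is a grid of vectors that stay away from 0, and the parity of the number of
    times a path in this grid crosses a fixed half-axis depends only on the ends
    of the path ([parity_grid]).  Hence the parities with which each arc winds
    around the ends of the other one are linked by an identity in which
    everything else depends only on the ends ([winding_pair]); summed over the 18
    pairs of disjoint edges of K33 this identity reads 0 = 1 ([K33_parity]).

    For graphs on at least nine vertices a bad realisation is found with
    switches, which replace two edges ab and cd by ac and bd.  If two vertices have
    degree 3, then in a realisation where they are adjacent and have as many
    common neighbours as possible the private neighbours of the two are twins,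
    and this forces K33 or a small cut ([two_cubic]).  If at most one vertex has
    degree 3, there is always a realisation that contains K33
    ([few_cubic_K33able]), by induction on the number of vertices: delete a
    vertex v and join some pairs of nonadjacent neighbours of v, so that the
    other neighbours lose one degree.  A copy of K33 in any realisation of the new degrees
    survives when v is put back onto edges outside the copy ([reduce0],
    [reduce1], [reduce2]).  In a degree class where no vertex can be deleted in
    this way, the neighbourhoods are so rigid that one or two more switches give a
    contradiction.

    The base of the induction and the graphs on at most eight vertices are
    settled by computation: for each degree sequence that satisfies the condition
    of Erdos and Gallai a greedy completion of a copy of K33, or of a small cut,
    gives a bad realisation ([nine_checked], [small_checked]), except for the ten
    exceptional sequences, whose realisations are enumerated and found to be
    isomorphic ([exceptional_checked]). *)

(** * Crossings of a half-axis, counted modulo two *)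

Section Winding.
Import Order.TTheory GRing.Theory Num.Theory numFieldNormedType.Exports.
Variable R : realType.
Local Open Scope ring_scope.
Implicit Types u v w : R * R.

(** The tie at height 0 is broken so that exactly one of u and - u is upper, for
    every nonzero u. *)
Definition upper u : bool := (0 < u.2) || (u.2 == 0) && (0 < u.1).

Lemma upperN u : u != 0 -> upper (- u) = ~~ upper u.
Proof.
case: u => x y; rewrite /upper /= !oppr_gt0 oppr_eq0 xpair_eqE negb_and.
by case: (ltrgtP y 0); case: (ltrgtP x 0).
Qed.

(** Vectors on different sides of the horizontal axis are both within d of it,
    hence both far from the vertical axis and on the same side of it. *)
Lemma upper_sign (d : R) u v : d <= `|u| -> d <= `|v| -> `|u - v| < d ->
  upper u != upper v -> ((0 < u.1) = (0 < v.1)) /\ (u.1 != 0).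
Proof.
case: u v => x y [x' y']; rewrite /upper !prod_normE /= !le_max => hu hv.
rewrite gt_max !ltr_norml => /andP[/andP[hx1 hx2] /andP[hy1 hy2]] nup.
have opp : (0 <= y) && (y' <= 0) || (y <= 0) && (0 <= y').
  by move: nup; case: (ltrgtP y 0) => // _; case: (ltrgtP y' 0).
have [hy hy'] : `|y| < d /\ `|y'| < d.
  by case/orP: opp => /andP[y1 y2]; rewrite !ltr_norml; split; lra.
have {hu}hu : d <= `|x| by move: hu; rewrite [X in _ || X]leNgt hy orbF.
have {hv}hv : d <= `|x'| by move: hv; rewrite [X in _ || X]leNgt hy' orbF.
have d0 : 0 < d by apply: le_lt_trans hy; rewrite normr_ge0.
by move: hu hv; rewrite !ler_normr => /orP[] h1 /orP[] h2; lra.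
Qed.

(** The parity of the crossings of the half-axis x > 0 by the step from u to v. *)
Definition crosses u v : bool := (upper u (+) upper v) && (0 < u.1).

(** The two ways around a cell of diameter less than d agree: either the cell lies
    on one side of the horizontal axis, or all its corners have the same sign of x. *)
Lemma crosses_cell (d : R) u1 u2 u3 u4 :
  all (fun u => d <= `|u|) [:: u1; u2; u3; u4] ->
  allrel (fun u v => `|u - v| < d) [:: u1; u2; u3; u4] [:: u1; u2; u3; u4] ->
  crosses u1 u2 (+) crosses u2 u3 = crosses u1 u4 (+) crosses u4 u3.
Proof.
rewrite /allrel /= !andbT => /and4P[n1 n2 n3 n4].
case/and4P=> /and4P[_ n12 n13 n14] /and4P[_ _ n23 n24] /and4P[_ _ _ n34] _.
have s12 := upper_sign n1 n2 n12; have s13 := upper_sign n1 n3 n13.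
have s14 := upper_sign n1 n4 n14; have s23 := upper_sign n2 n3 n23.
have s24 := upper_sign n2 n4 n24; have s34 := upper_sign n3 n4 n34.
move: s12 s13 s14 s23 s24 s34; rewrite /crosses.
case: (upper u1); case: (upper u2); case: (upper u3); case: (upper u4) => //=;
case: (0 < u1.1); case: (0 < u2.1); case: (0 < u3.1); case: (0 < u4.1) => //= h1 h2 h3 h4 h5 h6.
all: try by case: (h1 isT).
all: try by case: (h2 isT).
all: try by case: (h3 isT).
all: try by case: (h4 isT).
all: try by case: (h5 isT).
all: try by case: (h6 isT).
Qed.

Definition parity (u : nat -> R * R) n : bool :=
  \big[addb/false]_(m < n) crosses (u m) (u m.+1).

Lemma parityS (u : nat -> R * R) n : parity u n.+1 = parity u n (+) crosses (u n) (u n.+1).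
Proof. by rewrite /parity big_ord_recr. Qed.

(** Negation exchanges the two halves of the horizontal axis, and the crossings of
    the whole axis are counted by the sides of the two ends. *)
Lemma parityN (d : R) (u : nat -> R * R) n : (forall m, (m <= n)%N -> 0 < d <= `|u m|) ->
   (forall m, (m < n)%N -> `|u m - u m.+1| < d) ->
  parity (fun m => - u m) n = parity u n (+) (upper (u 0%N) (+) upper (u n)).
Proof.
elim: n => [|n IH] hu hs; first by rewrite /parity !big_ord0 addbb.
rewrite !parityS IH; [|by move=> m mn; apply: hu; lia|by move=> m mn; apply: hs; lia].
have /andP[d0 h1] := hu n (leqnSn n); have /andP[_ h2] := hu n.+1 (leqnn _).
have nz w : d <= `|w| -> w != 0 by rewrite -normr_gt0; apply: lt_le_trans.
have := upper_sign h1 h2 (hs n (leqnn _)); rewrite /crosses !upperN ?nz //=.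
rewrite oppr_gt0.
by case: (upper (u 0%N)); case: (parity u n); case: (upper (u n));
  case: (upper (u n.+1)) => //= h; have [_] := h isT; case: ltrgt0P.
Qed.

(** The vectors P m - Q l form a grid whose cells have diameter less than d and
    whose points are at distance at least d from 0; going along two sides of a
    rectangle gives the same parity as going along the other two. *)
Lemma parity_grid (d : R) (P Q : nat -> R * R) N :
  (forall m l, (m <= N)%N -> (l <= N)%N -> 0 < d <= `|P m - Q l|) ->
  (forall m, (m < N)%N -> `|P m - P m.+1| < d / 2) ->
  (forall m, (m < N)%N -> `|Q m - Q m.+1| < d / 2) ->
  forall m l, (m <= N)%N -> (l <= N)%N ->
  parity (fun i => P i - Q 0) m (+) parity (fun j => P m - Q j) l =
  parity (fun j => P 0 - Q j) l (+) parity (fun i => P i - Q l) m.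
Proof.
move=> hd hP hQ m l mN lN.
have d0 : 0 < d by have /andP[] := hd 0%N 0%N isT isT.
elim: m mN => [|m IHm] mN; first by rewrite /parity !big_ord0 addbF.
rewrite !parityS.
suff strip k : (k <= N)%N ->
   crosses (P m - Q 0%N) (P m.+1 - Q 0%N) (+) parity (fun j => P m.+1 - Q j) k =
   parity (fun j => P m - Q j) k (+) crosses (P m - Q k) (P m.+1 - Q k).
  by rewrite addbA -IHm ?(ltnW mN) // -!addbA strip.
elim: k => [|k IHk] kN; first by rewrite /parity !big_ord0 addbF addFb.
rewrite !parityS addbA IHk 1?ltnW // -!addbA; congr (_ (+) _).
have PP : `|P m - P m.+1| < d / 2 by exact: hP.
have QQ : `|Q k - Q k.+1| < d / 2 by exact: hQ.
have dd : d / 2 + d / 2 = d by lra.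
have hd2 : d / 2 < d by lra.
apply: (@crosses_cell d) => /=.
  have hd' i j : (i <= N)%N -> (j <= N)%N -> d <= `|P i - Q j|.
    by move=> iN jN; case/andP: (hd i j iN jN).
  by rewrite !hd' // ltnW.
have tri (a b c e : R * R) : `|a - c| < d / 2 -> `|b - e| < d / 2 ->
    `|a - b - (c - e)| < d.
  have -> : a - b - (c - e) = (a - c) - (b - e).
    by rewrite !opprB !addrA [a - b + e]addrAC [a - c + e]addrAC addrAC.
  by move=> ha hb; apply: le_lt_trans (ler_normB _ _) _; rewrite -dd ltrD.
have PP' := PP; rewrite distrC in PP'; have QQ' := QQ; rewrite distrC in QQ'.
have z0 (a : R * R) : `|a - a| < d / 2 by rewrite subrr normr0; lra.
by rewrite /allrel /= !tri.
Qed.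

(** The parity of the crossings of P with a half-axis that starts at c. *)
Definition winding (c : R * R) (P : nat -> R * R) N := parity (fun m => P m - c) N.

(** The four sides of the grid of differences, expressed by windings of either path
    around the ends of the other.  On the right only the ends occur. *)
Lemma winding_pair (d : R) (P Q : nat -> R * R) N :
  (forall m l, (m <= N)%N -> (l <= N)%N -> 0 < d <= `|P m - Q l|) ->
  (forall m, (m < N)%N -> `|P m - P m.+1| < d / 2) ->
  (forall m, (m < N)%N -> `|Q m - Q m.+1| < d / 2) ->
  winding (Q 0%N) P N (+) winding (Q N) P N (+) (winding (P 0%N) Q N (+) winding (P N) Q N) =
  upper (Q 0%N - P 0%N) (+) upper (Q N - P 0%N) (+) (upper (Q 0%N - P N) (+) upper (Q N - P N)).
Proof.
move=> hd hP hQ.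
have d0 : 0 < d by have /andP[] := hd 0%N 0%N isT isT.
have hd2 : d / 2 < d by lra.
have := parity_grid hd hP hQ (leqnn N) (leqnn N).
have side k : (k <= N)%N -> parity (fun j => P k - Q j) N =
    winding (P k) Q N (+) (upper (Q 0%N - P k) (+) upper (Q N - P k)).
  move=> kN; rewrite -(@parityN d).
  - by rewrite /parity; apply: eq_bigr => i _; rewrite !opprB.
  - by move=> m mN; rewrite distrC; apply: hd.
  by move=> m mN; rewrite opprB addrA subrK; apply: lt_trans hd2; apply: hQ.
rewrite !side // /winding.
do 2 case: (parity (fun m => P m - _) N); do 2 case: (parity (fun m => Q m - _) N);
by do 4 case: upper.
Qed.

End Winding.

(** * Arcs in the plane and the nonplanarity of the graph K33 *)

Section Arcs.
Import Order.TTheory GRing.Theory Num.Theory numFieldNormedType.Exports.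
Variable R : realType.
Local Open Scope ring_scope.
Local Open Scope classical_set_scope.

(** Uniform continuity, from the compactness of the unit interval. *)
Lemma arc_unif (f : R -> R * R) (e : R) : {within `[0, 1], continuous f} -> 0 < e ->
  exists2 n : R, 0 < n & forall s t, `[0, 1] s -> `[0, 1] t -> `|s - t| < n ->
    `|f s - f t| < e.
Proof.
move=> /subspace_continuousP cf e0.
have e20 : 0 < e / 2 by lra.
have := @segment_compact R 0 1; rewrite compact_near_coveringP => /near_covering_withinP.
move=> /(_ _ (0 : R)^'+ (fun n s => forall t, `[0, 1] t -> `|s - t| < n -> `|f s - f t| < e) _).
case=> [s s01|].
  have /cvgrPdist_lt/(_ _ e20) := cf _ s01.
  rewrite near_withinE => /nbhs_ballP[r /= r0 hr].
  have r20 : 0 < r / 2 by rewrite divr_gt0.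
  exists (ball s (r / 2), [set n : R | n < r / 2]).
    by split; [exact: nbhsx_ballx|exact: nbhs_right_lt].
  move=> [s' n] /= [bs' nr] s'01 t t01 s't.
  have h1 : `|f s - f s'| < e / 2.
    by apply: hr => //; apply: le_ball bs'; lra.
  have h2 : `|f s - f t| < e / 2.
    have hb : `|s - s'| < r / 2 by exact: bs'.
    apply: hr => //; rewrite /ball /=; have := ler_distD s' s t; lra.
  have -> : f s' - f t = (f s - f t) - (f s - f s') by rewrite opprB [RHS]addrC addrA subrK.
  by apply: le_lt_trans (ler_normB _ _) _; lra.
move=> n /= n0 H; exists (n / 2); first by rewrite divr_gt0.
move=> s t s01 t01 st; apply: (H (n / 2)) => //=; rewrite /ball /= ?divr_gt0 //.
by rewrite sub0r normrN gtr0_norm ?divr_gt0 //; lra.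
Qed.

(** The set of differences is compact and omits 0. *)
Lemma arc_sep (f g : R -> R * R) :
  {within `[0, 1], continuous f} -> {within `[0, 1], continuous g} ->
  (forall s t, `[0, 1] s -> `[0, 1] t -> f s != g t) ->
  exists2 d : R, 0 < d & forall s t, `[0, 1] s -> `[0, 1] t -> d <= `|f s - g t|.
Proof.
move=> cf cg fg.
have cpt (h : R -> R * R) : {within `[0, 1], continuous h} -> compact (h @` `[0, 1]).
  by move=> ch; apply: continuous_compact => //; exact: segment_compact.
have cD : compact ((fun p : (R * R) * (R * R) => p.1 - p.2) @` (f @` `[0, 1] `*` g @` `[0, 1])).
  apply: continuous_compact; last exact: compact_setX (cpt _ cf) (cpt _ cg).
  apply: continuous_subspaceT => p; apply: cvgB; [exact: cvg_fst|exact: cvg_snd].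
have /closed_openC oD := compact_closed (@norm_hausdorff _ _) cD.
have : nbhs (0 : R * R) (~` ((fun p : (R * R) * (R * R) => p.1 - p.2) @` (f @` `[0, 1] `*` g @` `[0, 1]))).
  apply: open_nbhs_nbhs; split => // -[[_ _] /= [[s s01 <-] [t t01 <-]] /eqP].
  by rewrite subr_eq0; apply/negP; exact: fg.
move=> /nbhs_ballP[d /= d0 hd]; exists d => // s t s01 t01.
rewrite leNgt; apply/negP => lt; apply: (hd (f s - g t)).
  by rewrite -ball_normE /= sub0r normrN.
by exists (f s, g t) => //; split; [exists s|exists t].
Qed.

End Arcs.

(** Here m i j k and n i j l stand for the windings of the edge from a i to b j around
    a k and b l.  Each of them occurs in exactly two of the 18 identities, each w i l in
    four, and there are 18 negations; the terms u cancel in pairs, and the terms v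
    contribute one for each of nine pairs of identities, an odd number. *)
Lemma K33_parity (m n : 'I_3 -> 'I_3 -> 'I_3 -> bool) (u v w : 'I_3 -> 'I_3 -> bool) :
  (forall j l, j != l -> v l j = ~~ v j l) ->
  (forall i j k l, i != k -> j != l ->
     m i j k (+) n i j l (+) (m k l i (+) n k l j) =
     u k i (+) ~~ w i l (+) (w k j (+) v l j)) -> False.
Proof.
move=> hv h.
pose o0 : 'I_3 := inord 0; pose o1 : 'I_3 := inord 1; pose o2 : 'I_3 := inord 2.
have n01 : o0 != o1 by rewrite -val_eqE /= !inordK.
have n02 : o0 != o2 by rewrite -val_eqE /= !inordK.
have n12 : o1 != o2 by rewrite -val_eqE /= !inordK.
(* The identities for (i, j), (k, l) and for (i, l), (k, j) are added, which removes
   u and leaves 1 for the two values of v. *)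
have pair i k j l : i != k -> j != l -> exists q : nat,
    (m i j k + n i j l + (m k l i + n k l j) + w i l + w k j +
     (m i l k + n i l j + (m k j i + n k j l) + w i j + w k l) + 1 = q.*2)%N.
  move=> ik jl; have lj := jl; rewrite eq_sym in lj.
  set N := (X in exists q, X = _); exists N./2; rewrite even_halfK // /N.
  rewrite !oddD !oddb (h i j k l) // (h i l k j) // (hv j l jl).
  by case: (u k i); case: (w i l); case: (w k j); case: (w i j); case: (w k l); case: (v j l).
have [q1 e1] := pair o0 o1 o0 o1 n01 n01; have [q2 e2] := pair o0 o1 o0 o2 n01 n02.
have [q3 e3] := pair o0 o1 o1 o2 n01 n12; have [q4 e4] := pair o0 o2 o0 o1 n02 n01.
have [q5 e5] := pair o0 o2 o0 o2 n02 n02; have [q6 e6] := pair o0 o2 o1 o2 n02 n12.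
have [q7 e7] := pair o1 o2 o0 o1 n12 n01; have [q8 e8] := pair o1 o2 o0 o2 n12 n02.
have [q9 e9] := pair o1 o2 o1 o2 n12 n12.
clear -e1 e2 e3 e4 e5 e6 e7 e8 e9; move: e1 e2 e3 e4 e5 e6 e7 e8 e9.
repeat match goal with |- context [nat_of_bool ?b] => move: (nat_of_bool b) => ? end.
lia.
Qed.

Section K33Arcs.
Import Order.TTheory GRing.Theory Num.Theory numFieldNormedType.Exports.
Variable R : realType.
Local Open Scope ring_scope.
Local Open Scope classical_set_scope.

Lemma finite_min (I : finType) (P : I -> R -> Prop) :
  (forall i (d d' : R), 0 < d' <= d -> P i d -> P i d') ->
  (forall i, exists2 d : R, 0 < d & P i d) -> exists2 d : R, 0 < d & forall i, P i d.
Proof.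
move=> mono ex.
have /choice[g hg] : forall i, exists d : R, 0 < d /\ P i d.
  by move=> i; have [d ? ?] := ex i; exists d.
have d0 : 0 < \big[Num.min/1]_i g i.
  by elim/big_ind: _ => // [x y x0 y0|i _]; [rewrite lt_min x0|case: (hg i)].
exists (\big[Num.min/1]_i g i) => // i; apply: (mono i (g i)); last by case: (hg i).
by rewrite d0 /=; apply: bigmin_le_cond.
Qed.

(** All nine arcs are sampled at the same multiples of 1 / N, with N so large that the
    steps are shorter than half the distance between any two disjoint arcs. *)
Theorem K33_arcs_meet (a b : 'I_3 -> R * R) (f : 'I_3 -> 'I_3 -> R -> R * R) :
  (forall i j, {within `[0, 1], continuous (f i j)}) ->
  (forall i j, f i j 0 = a i) -> (forall i j, f i j 1 = b j) ->
  ~ (forall i j k l s t, i != k -> j != l -> `[0, 1] s -> `[0, 1] t ->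
       f i j s != f k l t).
Proof.
move=> cf fa fb dis.
have [d d0 hd] : exists2 d : R, 0 < d & forall z : 'I_3 * 'I_3 * ('I_3 * 'I_3),
    z.1.1 != z.2.1 -> z.1.2 != z.2.2 -> forall s t, `[0, 1] s -> `[0, 1] t ->
    d <= `|f z.1.1 z.1.2 s - f z.2.1 z.2.2 t|.
  apply: finite_min => [z d d' /andP[_ dd] h ik jl s t s01 t01|[[i j] [k l]] /=].
    exact: le_trans dd (h ik jl s t s01 t01).
  have [ik|] := boolP (i != k); last by exists 1.
  have [jl|] := boolP (j != l); last by exists 1.
  have [d d0 h] := arc_sep (cf i j) (cf k l) (fun s t => dis i j k l s t ik jl).
  by exists d.
have d20 : 0 < d / 2 by rewrite divr_gt0.
have [e e0 he] : exists2 e : R, 0 < e & forall z : 'I_3 * 'I_3,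
    forall s t, `[0, 1] s -> `[0, 1] t -> `|s - t| < e -> `|f z.1 z.2 s - f z.1 z.2 t| < d / 2.
  apply: finite_min => [z r r' /andP[_ rr] h s t s01 t01 st|z].
    by apply: h => //; apply: lt_le_trans rr.
  exact: arc_unif.
have ei0 : 0 <= e^-1 by rewrite invr_ge0 ltW.
pose N := (Num.bound e^-1).
have hN : e^-1 < N%:R by exact: archi_boundP.
have N0 : 0 < N%:R :> R by apply: le_lt_trans hN.
pose P i j m := f i j (m%:R / N%:R).
have in01 m : (m <= N)%N -> `[0, 1] (m%:R / N%:R : R).
  by move=> mN; rewrite /= in_itv /= divr_ge0 //= ler_pdivrMr // mul1r ler_nat.
have P0 i j : P i j 0%N = a i by rewrite /P mul0r.
have PN i j : P i j N = b j by rewrite /P divff ?gt_eqF.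
have Psep i j k l m n : i != k -> j != l -> (m <= N)%N -> (n <= N)%N ->
    0 < d <= `|P i j m - P k l n|.
  by move=> ik jl mN nN; rewrite d0; apply: (hd ((i, j), (k, l))) => //; apply: in01.
have Pstep i j m : (m < N)%N -> `|P i j m - P i j m.+1| < d / 2.
  move=> mN; apply: (he (i, j)); [exact/in01/ltnW|exact: in01|].
  rewrite -mulrBl -natr1 opprD addrA subrr sub0r mulN1r normrN gtr0_norm ?invr_gt0 //.
  by rewrite invf_plt ?posrE.
have nz (x y : R * R) : 0 < d <= `|x - y| -> x - y != 0.
  by move=> /andP[_ h]; rewrite -normr_gt0; apply: lt_le_trans h.
pose o i : 'I_3 := ordS i.
have oi i : o i != i by case: i => [[|[|[|]]]].
apply: (@K33_parity (fun i j k => winding (a k) (P i j) N) (fun i j l => winding (b l) (P i j) N)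
  (fun k i => upper (a k - a i)) (fun l j => upper (b l - b j)) (fun k j => upper (a k - b j))).
  move=> j l jl; rewrite -(opprB (b j)) upperN //; apply: nz.
  rewrite -(PN (o j) j) -(PN j l); apply: Psep => //.
move=> i j k l ik jl.
have -> : ~~ upper (a i - b l) = upper (b l - a i).
  rewrite -(opprB (b l)) upperN ?negbK //; apply: nz.
  by rewrite -(PN k l) -(P0 i j); apply: Psep; rewrite // eq_sym.
have := winding_pair (fun m n hm hn => Psep i j k l m n ik jl hm hn) (@Pstep i j) (@Pstep k l).
by rewrite !P0 !PN.
Qed.

End K33Arcs.

(** * Graphs on a fixed vertex set and switches *)

Section Graphs.
Variable V : finType.
Implicit Types (e : rel V) (a b c d p q t u v w x y z : V).

Definition simple e := symmetric e /\ irreflexive e.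

(** This is convertible to the degree of the vertex in a graph with adjacency e. *)
Definition deg e x := #|[pred y | e x y]|.

(** The graph e with the pair ab toggled. *)
Definition flip a b e : rel V := fun x y =>
  e x y (+) ((x == a) && (y == b) || (x == b) && (y == a)).

Lemma simple_flip a b e : a != b -> simple e -> simple (flip a b e).
Proof.
move=> nab [sym irr]; split=> [x y|x]; rewrite /flip.
  by rewrite sym; congr (_ (+) _); rewrite orbC andbC [X in _ || X]andbC.
rewrite irr /=; apply/negbTE/negP => /orP[] /andP[/eqP-> E];
  by rewrite ?E // eq_sym E in nab.
Qed.

Lemma deg_add a b e x : simple e -> a != b -> ~~ e a b ->
  deg (flip a b e) x = deg e x + (x == a) + (x == b).
Proof.
move=> [sym _] nab nE.
have degB y z : ~~ e y z -> y != z ->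
    #|[pred w | e y w (+) (w == z)]| = (deg e y).+1.
  move=> nyz nez; rewrite (cardD1 z) !inE eqxx (negbTE nyz) add1n; congr _.+1.
  apply: eq_card => w; rewrite !inE; case: eqP => [->|_] /=; last by rewrite addbF.
  by rewrite (negbTE nyz).
rewrite {1}/deg /flip; case: (eqVneq x a) => [->|xa].
  rewrite (negbTE nab) addn0 addn1 -(degB a b) //.
  by apply: eq_card => w; rewrite !inE andTb andFb orbF.
case: (eqVneq x b) => [->|xb].
  rewrite addn0 addn1 -(degB b a) //; last by rewrite eq_sym.
  by rewrite sym.
by rewrite !addn0; apply: eq_card => w; rewrite !inE addbF.
Qed.

Lemma flipK a b e : flip a b (flip a b e) =2 e.
Proof. by move=> x y; rewrite /flip -addbA addbb addbF. Qed.

Lemma deg_rem a b e x : simple e -> e a b ->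
  deg (flip a b e) x + (x == a) + (x == b) = deg e x.
Proof.
move=> se eab; have nab : a != b.
  by apply: contraTneq eab => ->; rewrite se.2.
rewrite -deg_add //; first by apply: eq_card => w; rewrite !inE flipK.
  exact: simple_flip.
by rewrite /flip eab !eqxx.
Qed.

(** Replaces the edges ab and cd by ac and bd. *)
Definition switch a b c d e : rel V :=
  flip a c (flip b d (flip a b (flip c d e))).

End Graphs.

(** Decides the equalities between named vertices that arise when a flipped graph is
    unfolded, from the disequalities in the context. *)
Ltac decide_eq :=
  repeat match goal with
  | |- context [?x == ?x] => rewrite (eqxx x)
  | H : is_true (?x != ?y) |- context [?x == ?y] => rewrite (negbTE H)
  | H : is_true (?x != ?y) |- context [?y == ?x] => rewrite [y == x]eq_sym (negbTE H)
  end; rewrite ?(andbT, andbF, orbT, orbF, addbF, addbT, negbK) /=.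

Section Switch.
Variable V : finType.
Implicit Types (e : rel V) (a b c d p q t u v w x y z : V).

Lemma adj_neq e x y : simple e -> e x y -> x != y.
Proof. by move=> se exy; apply: contraTneq exy => ->; rewrite se.2. Qed.

Lemma nadj_neq e x y z : e x y -> ~~ e x z -> y != z.
Proof. by move=> exy; apply: contraNneq => <-. Qed.

Lemma switchP e a b c d : simple e -> e a b -> e c d ->
    ~~ e a c -> ~~ e b d -> a != c -> b != d ->
  [/\ simple (switch a b c d e), deg (switch a b c d e) =1 deg e,
      switch a b c d e a c /\ switch a b c d e b d,
      ~~ switch a b c d e a b /\ ~~ switch a b c d e c d &
      forall x y, ~~ (((x == a) || (x == d)) && ((y == b) || (y == c))) ->
        ~~ (((x == b) || (x == c)) && ((y == a) || (y == d))) ->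
        switch a b c d e x y = e x y].
Proof.
move=> se eab ecd nac nbd ac bd.
have [sym irr] := se.
have ab := adj_neq se eab; have cd := adj_neq se ecd.
have ad : a != d by rewrite eq_sym; apply: (@nadj_neq e c) => //; rewrite sym.
have bc : b != c by apply: (@nadj_neq e a).
split.
- by do 4 apply: simple_flip => //.
- move=> x; rewrite /switch.
  have s1 := simple_flip cd se; have s2 := simple_flip ab s1.
  have s3 := simple_flip bd s2.
  have E1 := deg_rem x se ecd.
  have E2 := @deg_rem _ a b _ x s1.
  have E3 := @deg_add _ b d _ x s2 bd.
  have E4 := @deg_add _ a c _ x s3 ac.
  rewrite -E1 -E2; last by rewrite /flip; decide_eq.
  rewrite E4; last by rewrite /flip; decide_eq.
  rewrite E3; last by rewrite /flip; decide_eq.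
  clear; rewrite -!addnA; congr (_ + _).
  case: (x == a) (x == b) (x == c) (x == d) => [] [] [] [] //.
- by rewrite /switch /flip; decide_eq; rewrite (negbTE nac) (negbTE nbd).
- by rewrite /switch /flip; decide_eq; rewrite eab ecd.
move=> x y; rewrite /switch /flip.
move: (x == a) (x == b) (x == c) (x == d) (y == a) (y == b) (y == c) (y == d).
by case=> [] [] [] [] [] [] [] [] //=; rewrite ?addbF.
Qed.

Definition K33 e := exists A B : seq V,
  [/\ uniq A /\ uniq B, size A = 3, size B = 3 & allrel e A B].

(** The set C is separated from y by the vertices of S, which may meet C. *)
Definition cut e := exists (S : seq V) (C : pred V) x y,
  [/\ size S <= 2, C x && (x \notin S), ~~ C y && (y \notin S) &
      forall u w, C u -> e u w -> C w || (w \in S)].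

Lemma K33_intro e (a1 a2 a3 : V) (W : pred V) : uniq [:: a1; a2; a3] ->
  2 < #|W| -> (forall w, W w -> [&& e a1 w, e a2 w & e a3 w]) -> K33 e.
Proof.
move=> uA /card_gt2P[b1 [b2 [b3 [[B1 B2 B3] [n12 n23 n31]]]]] WA.
exists [:: a1; a2; a3], [:: b1; b2; b3]; split=> //.
  by split=> //=; rewrite !inE negb_or n12 n23 eq_sym n31.
have /and3P[e11 e21 e31] := WA _ B1; have /and3P[e12 e22 e32] := WA _ B2.
have /and3P[e13 e23 e33] := WA _ B3.
by rewrite /allrel /= e11 e12 e13 e21 e22 e23 e31 e32 e33.
Qed.

Lemma K33_intro3 e (a1 a2 a3 b1 b2 b3 : V) :
  uniq [:: a1; a2; a3] -> uniq [:: b1; b2; b3] ->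
  [&& e a1 b1, e a1 b2 & e a1 b3] -> [&& e a2 b1, e a2 b2 & e a2 b3] ->
  [&& e a3 b1, e a3 b2 & e a3 b3] -> K33 e.
Proof.
move=> uA uB h1 h2 h3; exists [:: a1; a2; a3], [:: b1; b2; b3]; split=> //.
by rewrite /allrel /= !andbT h1 h2 h3.
Qed.

Lemma nbrsP e x : exists s : seq V,
  [/\ uniq s, size s = deg e x & forall y, e x y = (y \in s)].
Proof.
exists (enum [pred y | e x y]); split; first exact: enum_uniq.
  by rewrite /deg cardE.
by move=> y; rewrite mem_enum.
Qed.

Lemma nbrs3 e x : deg e x = 3 -> exists p q r,
  uniq [:: p; q; r] /\ (forall y, e x y = (y \in [:: p; q; r])).
Proof.
have [s [us ss hs]] := nbrsP e x; rewrite -ss.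
by case: s us ss hs => [|p [|q [|r []]]] //= us _ hs _; exists p, q, r.
Qed.

End Switch.

(** * Two vertices of degree three *)

Ltac neq := solve [assumption | rewrite eq_sym; assumption].
Ltac distinct := rewrite /= !inE ?negb_or ?andbT; repeat (apply/andP; split); neq.

Section Class.
Variable V : finType.
Implicit Types (e : rel V) (s : seq V).

Lemma fresh s : size s < #|V| -> exists z, z \notin s.
Proof.
move=> h; apply/existsP; rewrite -negb_forall; apply: contraTN h => /forallP all_s.
rewrite -leqNgt; apply: leq_trans (card_size s); apply: subset_leq_card.
by apply/fintype.subsetP => x _; exact: all_s.
Qed.

Lemma deg_sub e z s : (forall w, e z w -> w \in s) -> deg e z <= size s.
Proof.
move=> h; apply: leq_trans (card_size s); apply: subset_leq_card.
by apply/fintype.subsetP => x; rewrite !inE; exact: h.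
Qed.

Lemma nbr_out e z s : size s < deg e z -> exists2 y, e z y & y \notin s.
Proof.
move=> h; apply: contrapT => no; move: h; apply/negP; rewrite -leqNgt.
apply: deg_sub => w ezw; apply: contrapT => /negP ws; apply: no; by exists w.
Qed.

Lemma nbrs_ext e z s : uniq s -> all (e z) s -> exists r : seq V,
  [/\ uniq (s ++ r), size s + size r = deg e z & forall w, e z w = (w \in s ++ r)].
Proof.
move=> us /allP es; exists [seq w <- enum V | e z w && (w \notin s)].
set r := seq.filter _ _.
have rP w : (w \in r) = e z w && (w \notin s) by rewrite mem_filter mem_enum andbT.
have u : uniq (s ++ r).
  rewrite cat_uniq us filter_uniq ?enum_uniq // andbT /=.
  by apply/hasPn => w; rewrite rP => /andP[].
have m w : e z w = (w \in s ++ r).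
  rewrite mem_cat rP; case: (boolP (w \in s)) => [/es ->|] //=; by rewrite andbT.
split=> //; rewrite -size_cat -(card_uniqP u) /deg.
by apply: eq_card => w; rewrite !inE m.
Qed.

(** Degree classes are finite, but they are described by a proposition; a bounded
    measure still attains its maximum there. *)
Lemma ex_maximal (T : Type) (P : T -> Prop) (m : T -> nat) (B : nat) :
  (exists x, P x) -> (forall x, m x <= B) ->
  exists x, P x /\ forall y, P y -> m y <= m x.
Proof.
move=> [x0 Px0] mB.
have exP : exists n, `[< exists2 x, P x & m x = n >] by exists (m x0); apply/asboolP; exists x0.
have ub n : `[< exists2 x, P x & m x = n >] -> n <= B by move=> /asboolP[x _ <-].
case: (ex_maxnP exP ub) => n /asboolP[x Px <-] maxn; exists x; split=> // y Py.
by apply: maxn; apply/asboolP; exists y.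
Qed.

End Class.

Section TwoCubic.
Variables (V : finType) (e0 : rel V).
Implicit Types (e : rel V) (t u v w x y z p q : V).
Hypothesis n9 : 9 <= #|V|.
Hypothesis dge : forall x, 3 <= deg e0 x.

(** The class that is searched for a bad graph: all switches stay inside it. *)
Definition same_degrees e := simple e /\ deg e =1 deg e0.
Hypothesis nK : forall e, same_degrees e -> ~ K33 e.
Hypothesis nC : forall e, same_degrees e -> ~ cut e.

Lemma switch_same_degrees e a b c d : same_degrees e -> e a b -> e c d ->
  ~~ e a c -> ~~ e b d -> a != c -> b != d -> same_degrees (switch a b c d e).
Proof.
move=> [se de] ab cd nac nbd ac bd.
have [s' d' _ _ _] := switchP se ab cd nac nbd ac bd.
by split=> // x; rewrite d' de.
Qed.

Section Link.
Variables t1 t2 : V.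
Hypotheses (t12 : t1 != t2) (d1 : deg e0 t1 = 3) (d2 : deg e0 t2 = 3).
Hypothesis far : forall e, same_degrees e -> ~~ e t1 t2.

(** Otherwise a switch would join t1 and t2. *)
Lemma far_block e x y : same_degrees e -> e t1 x -> e t2 y -> x != y -> e x y.
Proof.
move=> ge ex ey xy; apply: contrapT => /negP nxy.
have g' := switch_same_degrees ge ex ey (far ge) nxy t12 xy.
have [_ _ [h _] _ _] := switchP ge.1 ex ey (far ge) nxy t12 xy.
by have := far g'; rewrite h.
Qed.

(** Two private neighbours of t1 are adjacent to all of N(t2), and so is t2 itself. *)
Lemma far_common e x x' : same_degrees e -> e t1 x -> e t1 x' -> x != x' ->
  e t2 x || e t2 x'.
Proof.
move=> ge ex ex' xx'; apply: contrapT => /negP; rewrite negb_or => /andP[nx nx'].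
have xt := nadj_neq ex (far ge); have xt' := nadj_neq ex' (far ge).
apply: (nK ge); apply: (@K33_intro _ _ x x' t2 [pred y | e t2 y]); first by distinct.
  by have -> : #|[pred y | e t2 y]| = 3 := etrans (ge.2 t2) d2.
move=> w /= ew; rewrite ew andbT !(far_block ge _ ew) //.
  by apply: contraNneq nx' => ->.
by apply: contraNneq nx => ->.
Qed.

(** If t1 and t2 are adjacent in no realisation, they have two common neighbours a and
    b, and N(t1) = {a, b, x}, N(t2) = {a, b, y} with possibly x = y.  An edge uv away
    from these vertices could be switched with an edge from t1 to a vertex m that is
    not adjacent to v; then u is a neighbour of t1, so u is adjacent to a, b and y, which
    gives K33.  Hence there is no such edge, and every other vertex sends at least
    three edges to {a, b, x, y}; three such vertices are too many. *)
Lemma far_false : (exists e, same_degrees e) -> False.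
Proof.
move=> [e ge]; have [[sym irr] de] := ge.
have [a [b [x [uabx ha hb N1]]]] : exists a b x, [/\ uniq [:: a; b; x],
    e t2 a, e t2 b & forall w, e t1 w = (w \in [:: a; b; x])].
  have [p [q [r [u N1]]]] := nbrs3 (etrans (de t1) d1).
  have [P Q S] : [/\ e t1 p, e t1 q & e t1 r] by rewrite !N1 !inE !eqxx !orbT.
  move: (u); rewrite /= !inE negb_or => /and3P[/andP[pq pr] qr _].
  have := far_common ge Q S qr; have := far_common ge P S pr; have := far_common ge P Q pq.
  have [hp|np] /= := boolP (e t2 p); have [hq|nq] /= := boolP (e t2 q) => //= h1 h2 h3.
  - by exists p, q, r.
  - exists p, r, q; split=> //; first by distinct.
    by move=> w; rewrite N1 !inE orbCA orbC -orbA orbCA.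
  exists q, r, p; split=> //; first by distinct.
  by move=> w; rewrite N1 !inE orbC -orbA.
have [y [uaby N2]] : exists y, uniq [:: a; b; y] /\
    forall w, e t2 w = (w \in [:: a; b; y]).
  have [||r [ur sr N2]] := @nbrs_ext _ e t2 [:: a; b].
  - by move: uabx; rewrite /= !inE negb_or => /and3P[/andP[-> _] _ _].
  - by rewrite /= ha hb.
  by move: sr ur N2; rewrite de d2; case: r => [|y []] //= _ ur N2; exists y.
have [e1a e1b e1x] : [/\ e t1 a, e t1 b & e t1 x] by rewrite !N1 !inE !eqxx !orbT.
have e2y : e t2 y by rewrite N2 !inE eqxx !orbT.
move: (uabx) (uaby); rewrite /= !inE !negb_or.
move=> /and3P[/andP[ab ax] bx _] /and3P[/andP[_ ay] by' _].
have eab : e a b by apply: (far_block ge).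
have eay : e a y by apply: (far_block ge).
have eby : e b y by apply: (far_block ge).
have eax : e a x by rewrite sym; apply: (far_block ge); rewrite // eq_sym.
have ebx : e b x by rewrite sym; apply: (far_block ge); rewrite // eq_sym.
have nt1 w : e t1 w -> w != t1 /\ w != t2.
  by move=> h; split; [rewrite eq_sym (adj_neq ge.1 h)|apply: nadj_neq h (far ge)].
have nt2 w : e t2 w -> w != t1 /\ w != t2.
  move=> h; split; last by rewrite eq_sym (adj_neq ge.1 h).
  by apply: nadj_neq h _; rewrite sym (far ge).
have [a1 a2] := nt1 a e1a; have [b1 b2] := nt1 b e1b.
have [x1 x2] := nt1 x e1x; have [y1 y2] := nt2 y e2y.
have K := nK ge.
(* A third vertex adjacent to all of N(t1), or to all of N(t2), completes K33. *)
have noX z : z != t1 -> z != t2 -> z != y -> e z a -> e z b -> ~~ e z x.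
  move=> z1 z2 zy za zb; apply/negP => zx; have [E|xy] := eqVneq x y.
    apply: K; apply: (@K33_intro3 _ _ z t1 t2 a b x); try by distinct.
    - by rewrite za zb zx.
    - by rewrite e1a e1b e1x.
    by rewrite ha hb E e2y.
  apply: K; apply: (@K33_intro3 _ _ z t1 y a b x); try by distinct.
  - by rewrite za zb zx.
  - by rewrite e1a e1b e1x.
  by rewrite ![e y _]sym eay eby (far_block ge).
have noY z : z != t1 -> z != t2 -> z != x -> e z a -> e z b -> ~~ e z y.
  move=> z1 z2 zy za zb; apply/negP => zx; have [E|xy] := eqVneq x y.
    apply: K; apply: (@K33_intro3 _ _ z t1 t2 a b x); try by distinct.
    - by rewrite za zb E zx.
    - by rewrite e1a e1b e1x.
    by rewrite ha hb E e2y.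
  apply: K; apply: (@K33_intro3 _ _ z t2 x a b y); try by distinct.
  - by rewrite za zb zx.
  - by rewrite ha hb e2y.
  by rewrite ![e x _]sym eax ebx sym (far_block ge).
pose O := [:: t1; t2; a; b; x; y].
have noE u v : u \notin O -> v \notin O -> ~~ e u v.
  rewrite !inE !negb_or => /and5P[u1 u2 ua ub /andP[ux uy]].
  move=> /and5P[v1 v2 va vb /andP[vx vy]]; apply/negP => uv.
  have [m m3 nvm] : exists2 m, e t1 m & ~~ e v m.
    have [va'|] := boolP (e v a); last by exists a.
    have [vb'|] := boolP (e v b); last by exists b.
    by exists x => //; apply: noX.
  have nu : ~~ e t1 u by rewrite N1 !inE !negb_or ua ub.
  have tu : t1 != u by rewrite eq_sym.
  have mv : m != v by apply: nadj_neq m3 _; rewrite N1 !inE !negb_or va vb.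
  rewrite sym in nvm; have g' := switch_same_degrees ge m3 uv nu nvm tu mv.
  have [_ _ [h _] _ E] := switchP ge.1 m3 uv nu nvm tu mv.
  have [m1 m2] := nt1 m m3.
  have new w : e t2 w -> u != w -> e u w.
    move=> hw uw; have [w1 w2] := nt2 w hw.
    have wv : w != v by apply: contraTneq hw => ->; rewrite N2 !inE !negb_or va vb.
    have uv' := adj_neq ge.1 uv.
    have := far_block g' h; move/(_ w); rewrite !E; solve [by apply | by decide_eq].
  by have /negP := noY u u1 u2 ux (new a ha ua) (new b hb ub); apply; apply: new.
have nbO z : z \notin O -> forall w, e z w -> w \in [:: a; b; x; y].
  move=> zO w zw; move: (zO); rewrite !inE !negb_or => /and5P[z1 z2 za zb /andP[zx zy]].
  have wO : w \in O by apply: contraTT zw => /(noE _ _ zO).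
  move: wO; rewrite !inE => /orP[/eqP w1|/orP[/eqP w2|//]].
    by move: zw; rewrite w1 sym N1 !inE (negbTE za) (negbTE zb) (negbTE zx).
  by move: zw; rewrite w2 sym N2 !inE (negbTE za) (negbTE zb) (negbTE zy).
have miss z w1 w2 : z \notin O -> ~~ e z w1 -> ~~ e z w2 -> w1 != w2 ->
    w1 \in [:: a; b; x; y] -> w2 \in [:: a; b; x; y] -> False.
  move=> zO n1 n2 w12 m1 m2; have := dge z; rewrite -de leqNgt => /negP; apply.
  pose s := rem w2 (rem w1 [:: a; b; x; y]).
  have ss : size s = 2.
    rewrite /s size_rem ?size_rem //.
    by rewrite (rem_mem _ m2) // eq_sym.
  rewrite -ss ltnS; apply: deg_sub => w ew.
  have := nbO z zO w ew; have wn1 := nadj_neq ew n1; have wn2 := nadj_neq ew n2.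
  by move=> h; rewrite /s rem_mem // rem_mem.
have full z : z \notin O -> [/\ e z x, e z y, x != y & e z a || e z b].
  move=> zO; move: (zO); rewrite !inE !negb_or => /and5P[z1 z2 za zb /andP[zx zy]].
  have ex : e z x.
    apply: contrapT => /negP nx; have := miss z x _ zO nx.
    have [ea|na] := boolP (e z a); last by move/(_ a na); rewrite eq_sym !inE !eqxx !orbT; apply.
    have [eb|nb] := boolP (e z b); last by move/(_ b nb); rewrite eq_sym !inE !eqxx !orbT; apply.
    have [xy|xy] := eqVneq x y; last first.
      by move/(_ y (noY z z1 z2 zx ea eb) xy); rewrite !inE !eqxx !orbT; apply.
    have := dge z; rewrite -de leqNgt => /negP h _; apply: h; rewrite ltnS.
    apply: (@deg_sub _ _ _ [:: a; b]) => w ew; have := nbO z zO w ew.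
    by rewrite !inE -xy orbb (negbTE (nadj_neq ew nx)) !orbF.
  have ey : e z y.
    apply: contrapT => /negP ny; have := miss z y _ zO ny.
    have [ea|na] := boolP (e z a); last by move/(_ a na); rewrite eq_sym !inE !eqxx !orbT; apply.
    have [eb|nb] := boolP (e z b); last by move/(_ b nb); rewrite eq_sym !inE !eqxx !orbT; apply.
    by have := noX z z1 z2 zy ea eb; rewrite ex.
  have xy : x != y.
    apply: contraT; rewrite negbK => /eqP xy.
    have [ea|na] := boolP (e z a); last first.
      have [eb|nb] := boolP (e z b); last by case: (miss z a b) => //; rewrite !inE eqxx ?orbT.
      have := dge z; rewrite -de leqNgt => /negP; case; rewrite ltnS.
      apply: (@deg_sub _ _ _ [:: b; y]) => w ew; have := nbO z zO w ew.
      by rewrite !inE xy orbb (negbTE (nadj_neq ew na)).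
    have [eb|nb] := boolP (e z b); first by have := noX z z1 z2 zy ea eb; rewrite ex.
    have := dge z; rewrite -de leqNgt => /negP; case; rewrite ltnS.
    apply: (@deg_sub _ _ _ [:: a; y]) => w ew; have := nbO z zO w ew.
    by rewrite !inE xy orbb (negbTE (nadj_neq ew nb)).
  split=> //; apply: contraT; rewrite negb_or => /andP[na nb].
  by case: (miss z a b) => //; rewrite !inE eqxx ?orbT.
have two c c' z z' : z \notin O -> z' \notin O -> z != z' -> c \in [:: a; b] ->
   c' \in [:: a; b] -> c != c' -> e c c' -> e c x -> e c y -> e z c' -> e z' c' -> False.
  move=> zO zO' zz' hc hc' cc' ecc' ecx ecy zc z'c.
  have [zx zy xy _] := full z zO; have [z'x z'y _ _] := full z' zO'.
  have cO : c \in O by move: hc; rewrite !inE => /orP[] /eqP->; rewrite eqxx ?orbT.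
  have cz : c != z by apply: contraNneq zO => <-.
  have cz' : c != z' by apply: contraNneq zO' => <-.
  have c'x : c' != x by move: hc'; rewrite !inE => /orP[] /eqP->.
  have c'y : c' != y by move: hc'; rewrite !inE => /orP[] /eqP->.
  apply: K; apply: (@K33_intro3 _ _ z z' c c' x y); try by distinct.
  - by rewrite zc zx zy.
  - by rewrite z'c z'x z'y.
  by rewrite ecc' ecx ecy.
have eba : e b a by rewrite sym.
have ba : b != a by rewrite eq_sym.
have A2 z z' : z \notin O -> z' \notin O -> z != z' -> e z a -> e z' a -> False.
  by move=> zO zO' zz'; apply: (two b a) => //; rewrite !inE eqxx ?orbT.
have B2 z z' : z \notin O -> z' \notin O -> z != z' -> e z b -> e z' b -> False.
  by move=> zO zO' zz'; apply: (two a b) => //; rewrite !inE eqxx ?orbT.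
have [z1 z1O] := fresh (leq_trans (isT : size O < 9) n9).
have [z2] := fresh (leq_trans (isT : size (z1 :: O) < 9) n9).
rewrite inE negb_or => /andP[z21 z2O].
have [z3] := fresh (leq_trans (isT : size (z1 :: z2 :: O) < 9) n9).
rewrite in_cons negb_or => /andP[z31]; rewrite in_cons negb_or => /andP[z32 z3O].
have [_ _ _ /orP h1] := full z1 z1O; have [_ _ _ /orP h2] := full z2 z2O.
have [_ _ _ /orP h3] := full z3 z3O.
case: h1 => h1; case: h2 => h2; case: h3 => h3;
  solve [exact: (A2 z2 z1) | exact: (A2 z3 z1) | exact: (A2 z3 z2)
        |exact: (B2 z2 z1) | exact: (B2 z3 z1) | exact: (B2 z3 z2)].
Qed.

End Link.

Definition common e t t' := #|[pred y | e t y && e t' y]|.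

(** Common neighbours are maximised over the realisations that keep t and t' adjacent. *)
Definition common_max e t t' :=
  forall e', same_degrees e' -> e' t t' -> common e' t t' <= common e t t'.

Lemma common_sym e t t' : common e t t' = common e t' t.
Proof. by apply: eq_card => y; rewrite !inE andbC. Qed.

(** If y were adjacent to p only, the switch of t'p' and py would turn p into a new
    common neighbour of t and t' at the expense of p', which is not one. *)
Lemma twins e t t' p p' y : same_degrees e -> common_max e t t' -> e t t' ->
  e t p -> ~~ e t' p -> e t' p' -> ~~ e t p' -> p != t' -> p' != t ->
  y \notin [:: t; t'; p; p'] -> e p y -> e p' y.
Proof.
move=> ge emax tt' tp t'p t'p' tp' pt' p't; rewrite !inE !negb_or.
move=> /and4P[yt yt' yp yp'] py; apply: contrapT => /negP p'y.
have t'p_ : t' != p by rewrite eq_sym.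
have p'y_ : p' != y by rewrite eq_sym.
have g' := switch_same_degrees ge t'p' py t'p p'y t'p_ p'y_.
have [_ _ [h _] _ E] := switchP ge.1 t'p' py t'p p'y t'p_ p'y_.
have p't' : p' != t' by rewrite eq_sym (adj_neq ge.1 t'p').
have pt : p != t by rewrite eq_sym (adj_neq ge.1 tp).
have tt := adj_neq ge.1 tt'.
have Et w : switch t' p' p y e t w = e t w by apply: E; decide_eq.
have /(emax _ g') : switch t' p' p y e t t' by rewrite Et.
rewrite leqNgt => /negP; apply; apply: proper_card; apply/properP; split.
  apply/fintype.subsetP => w; rewrite !inE Et => /andP[tw t'w]; rewrite tw /= E ?t'w //.
    by have wp := nadj_neq t'w t'p; have wp' := nadj_neq tw tp'; decide_eq.
  by decide_eq.
exists p; rewrite !inE ?(negbTE t'p) ?andbF //.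
by rewrite Et tp h.
Qed.

(** The same as a cut, with the separating set given as a predicate. *)
Lemma cut_small e (C : pred V) (W : pred V) x y : same_degrees e -> #|W| <= 2 ->
  C x -> ~~ W x -> ~~ C y -> ~~ W y ->
  (forall u w, C u -> e u w -> C w || W w) -> False.
Proof.
move=> ge W2 Cx Wx Cy Wy closed; apply: (nC ge).
exists (enum W), C, x, y; rewrite -cardE Cx Cy !mem_enum Wx Wy; split=> // u w.
by rewrite mem_enum; exact: closed.
Qed.

Lemma nbr_common e p p' p'' (W : pred V) : same_degrees e -> uniq [:: p; p'; p''] ->
  (forall w, W w -> [&& e p w, e p' w & e p'' w]) -> #|W| <= 2.
Proof.
by move=> ge u h; rewrite leqNgt; apply/negP => W2; apply: (nK ge); apply: K33_intro h.
Qed.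

(** Without common neighbours the four private neighbours are pairwise twins towards the
    rest W of the graph: either three of them and W give K33, or W is small and
    separates. *)
Lemma common0_false e t1 t2 p q p' q' : same_degrees e -> common_max e t1 t2 ->
  uniq [:: t1; t2; p; q; p'; q'] ->
  (forall w, e t1 w = (w \in [:: t2; p; q])) ->
  (forall w, e t2 w = (w \in [:: t1; p'; q'])) -> False.
Proof.
move=> ge emax u N1 N2; have emax' : common_max e t2 t1.
  by move=> e' g' a; rewrite ![common _ t2 _]common_sym; apply: emax; rewrite // g'.1.1.
pose L := [:: t1; t2; p; q; p'; q'].
move: (u); rewrite /= !inE !negb_or.
move=> /and5P[/and5P[t12 t1p t1q t1p' t1q'] /and4P[t2p t2q t2p' t2q']].
move=> /and3P[pq pp' pq'] /andP[qp' qq'] /andP[pq'' _].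
have T1 a b y : a \in [:: p; q] -> b \in [:: p'; q'] -> y \notin L ->
    (e a y -> e b y) /\ (e b y -> e a y).
  move=> ha hb yL.
  have [aL bL] : a \in L /\ b \in L.
    by split; [move: ha|move: hb]; rewrite !inE => /orP[]->; rewrite ?orbT.
  have ta : e t1 a by rewrite N1 inE ha orbT.
  have tb : e t2 b by rewrite N2 inE hb orbT.
  have nta : ~~ e t2 a.
    by rewrite N2; move: ha; rewrite !inE => /orP[] /eqP->; rewrite !negb_or;
      repeat (apply/andP; split); neq.
  have ntb : ~~ e t1 b.
    by rewrite N1; move: hb; rewrite !inE => /orP[] /eqP->; rewrite !negb_or;
      repeat (apply/andP; split); neq.
  have at2 : a != t2 by move: ha; rewrite !inE => /orP[] /eqP->; neq.
  have bt1 : b != t1 by move: hb; rewrite !inE => /orP[] /eqP->; neq.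
  have e12 : e t1 t2 by rewrite N1 inE eqxx.
  have yn : y \notin [:: t1; t2; a; b].
    apply: contra yL; rewrite !in_cons => /or4P[/eqP->|/eqP->|/eqP->|/orP[/eqP->|//]] //.
      by rewrite eqxx.
    by rewrite eqxx orbT.
  split; first exact: (twins ge emax e12 ta nta tb ntb).
  apply: (twins ge emax' _ tb ntb ta nta) => //; first by rewrite ge.1.1.
  by apply: contra yn; rewrite !inE orbCA => /or4P[]->; rewrite ?orbT.
pose W := [pred y | e p y && (y \notin L)].
have pI : p \in [:: p; q] by rewrite inE eqxx.
have qI : q \in [:: p; q] by rewrite !inE eqxx orbT.
have p'I : p' \in [:: p'; q'] by rewrite inE eqxx.
have q'I : q' \in [:: p'; q'] by rewrite !inE eqxx orbT.
have WP a y : a \in [:: p; q; p'; q'] -> y \notin L -> e a y = e p y.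
  move=> ha yL; apply/idP/idP.
    move: ha; rewrite !inE => /or4P[] /eqP-> // h.
    - by apply: (T1 p p' y _ _ _).2 => //; apply: (T1 q p' y _ _ _).1.
    - by apply: (T1 p p' y _ _ _).2.
    by apply: (T1 p q' y _ _ _).2.
  move: ha; rewrite !inE => /or4P[] /eqP-> // h.
  - by apply: (T1 q p' y _ _ _).2 => //; apply: (T1 p p' y _ _ _).1.
  - by apply: (T1 p p' y _ _ _).1.
  by apply: (T1 p q' y _ _ _).1.
have W2 : #|W| <= 2.
  apply: (@nbr_common e p q p' W ge); first by distinct.
  move=> w /andP[pw wL]; by rewrite (WP q) ?(WP p') ?pw // !inE eqxx ?orbT.
have [z zn] : exists z, z \notin L ++ enum W.
  by apply: fresh; rewrite size_cat -cardE; apply: leq_trans n9; rewrite !addSn !ltnS.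
move: zn; rewrite mem_cat negb_or mem_enum => /andP[zL zW].
apply: (@cut_small e (mem L) W t1 z) => //.
- by rewrite /= inE eqxx.
- by rewrite /= [t1 \in L]inE eqxx andbF.
move=> a w aL aw; apply/orP; have [wL|wL] := boolP (w \in L); [by left|right].
rewrite /W /= wL andbT.
move: aL; rewrite /= in_cons => /orP[/eqP E|].
  case/negP: wL; move: aw; rewrite E N1 !inE => /or3P[]->; by rewrite ?orbT.
rewrite in_cons => /orP[/eqP E|ha].
  case/negP: wL; move: aw; rewrite E N2 !inE => /or3P[]->; by rewrite ?orbT.
by rewrite -(WP a).
Qed.

(** Let C = {t1, t2, p, p'} and let W be the common neighbourhood of the twins p and p'
    outside C.  If W and q have at most two members they form a cut.  For an edge xv
    away from C, with x outside W and v distinct from q, the switch of t2p' and vx makes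
    v the private neighbour of t2, so that v is a twin of p as well.  This excludes all
    vertices outside C, W and q, whence W is large. *)
Lemma common1_false e t1 t2 p p' q : same_degrees e -> common_max e t1 t2 ->
  uniq [:: t1; t2; p; p'; q] ->
  (forall w, e t1 w = (w \in [:: t2; p; q])) ->
  (forall w, e t2 w = (w \in [:: t1; p'; q])) -> False.
Proof.
move=> ge emax u N1 N2; have [[sym irr] de] := ge.
pose C := [:: t1; t2; p; p']; pose W := [pred y | e p y && (y \notin C)].
move: (u); rewrite /= !inE !negb_or.
move=> /and5P[/and4P[t12 t1p t1p' t1q] /and3P[t2p t2p' t2q] /andP[pp' pq] p'q _].
have e12 : e t1 t2 by rewrite N1 inE eqxx.
have e1p : e t1 p by rewrite N1 !inE eqxx orbT.
have e2p' : e t2 p' by rewrite N2 !inE eqxx orbT.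
have n1p' : ~~ e t1 p' by rewrite N1 !inE !negb_or; repeat (apply/andP; split); neq.
have n2p : ~~ e t2 p by rewrite N2 !inE !negb_or; repeat (apply/andP; split); neq.
have max' e' : common_max e' t1 t2 -> common_max e' t2 t1.
  by move=> em e'' g' a; rewrite ![common _ t2 _]common_sym; apply: em; rewrite // g'.1.1.
have WP y : y \notin C -> e p' y = e p y.
  move=> yC; apply/idP/idP.
    apply: (twins ge (max' _ emax) _ e2p' n1p' e1p n2p); rewrite // 1?eq_sym //; first by rewrite sym.
    by apply: contra yC; rewrite !inE => /or4P[]->; rewrite ?orbT.
  by apply: (twins ge emax e12 e1p n2p e2p' n1p'); rewrite // 1?eq_sym.
have CP y : y \notin C -> [&& y != t1, y != t2, y != p & y != p'].
  by rewrite !inE !negb_or.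
have WE y : y \notin C -> W y = e p y.
  by move=> yC; rewrite -[W y]/(e p y && (y \notin C)) yC andbT.
have CW a w : a \in C -> e a w -> [|| w \in C, w == q | W w].
  move=> aC aw; have [//|wC] := boolP (w \in C); move: aC wC aw.
  rewrite /C !in_cons => /or4P[/eqP->|/eqP->|/eqP->|/orP[/eqP->|//]] wC aw.
  - move: aw wC; rewrite N1 !inE !negb_or => /or3P[]->; rewrite ?orbT ?andbF //.
  - move: aw wC; rewrite N2 !inE !negb_or => /or3P[]->; rewrite ?orbT ?andbF //.
  - by rewrite /= aw /C wC orbT.
  by rewrite /= -WP // aw /C wC orbT.
have t1S : ~~ [predU1 q & W] t1.
  by rewrite /= negb_or t1q /= negb_and negbK in_cons eqxx orbT.
have bigS : 2 < #|[predU1 q & W]|.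
  rewrite ltnNge; apply/negP => S2.
  have [z] : exists z, z \notin C ++ enum [predU1 q & W].
    apply: fresh; rewrite size_cat -cardE.
    exact: leq_ltn_trans (leq_add (leqnn (size C)) S2) (leq_trans _ n9).
  rewrite mem_cat negb_or mem_enum => /andP[zC zS].
  apply: (@cut_small e (mem C) [predU1 q & W] t1 z) => //.
  by rewrite /= inE eqxx.
have cardS : #|[predU1 q & W]| = (~~ W q) + #|W| by rewrite cardU1.
have W2 : 1 < #|W|.
  by move: bigS; rewrite cardS; case: (W q); rewrite ?add0n ?add1n //; apply: ltnW.
(* The twin relation of p and v after the switch, read off in the graph before it. *)
have outsider v x : x \notin C -> v \notin C -> e x v -> ~~ W x -> v != q ->
    e p p' = W v /\ forall y, y \notin C -> y != x -> y != v -> W y = e v y.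
  move=> xC vC xv nWx vq.
  have /and4P[x1 x2 xp xp'] := CP x xC; have /and4P[v1 v2 vp vp'] := CP v vC.
  have n2v : ~~ e t2 v by rewrite N2 !inE !negb_or v1 vp'.
  have n1v : ~~ e t1 v by rewrite N1 !inE !negb_or v2 vp.
  have np'x : ~~ e p' x by rewrite WP // -WE.
  have t2v : t2 != v by rewrite eq_sym.
  have p'x : p' != x by rewrite eq_sym.
  have vx : e v x by rewrite sym.
  have xv' := adj_neq ge.1 xv.
  have g' := switch_same_degrees ge e2p' vx n2v np'x t2v p'x.
  have [_ _ [h _] _ E] := switchP ge.1 e2p' vx n2v np'x t2v p'x.
  set e' := switch _ _ _ _ _ in g' h E.
  have E1 w : e' t1 w = e t1 w by apply: E; decide_eq.
  have Ep w : e' p w = e p w by apply: E; decide_eq.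
  have Ev w : w != t2 -> w != x -> e' v w = e v w by move=> w2 wx; apply: E; decide_eq.
  have emax' : common_max e' t1 t2.
    move=> e'' g'' a; apply: leq_trans (emax _ g'' a) _; apply: subset_leq_card.
    apply/fintype.subsetP => w; rewrite !inE E1 => /andP[w1 w2]; rewrite w1 /=.
    have wp' := nadj_neq w1 n1p'; have wv := nadj_neq w1 n1v.
    by rewrite E //; decide_eq.
  have n2p' : ~~ e' t2 p by rewrite E //; decide_eq.
  have e'12 : e' t1 t2 by rewrite E1.
  have e'21 : e' t2 t1 by rewrite g'.1.1.
  have e'1p : e' t1 p by rewrite E1.
  have n1v' : ~~ e' t1 v by rewrite E1.
  have pt2 : p != t2 by rewrite eq_sym.
  have tw y : y \notin [:: t1; t2; p; v] -> e p y = e' v y.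
    move=> yn; have yn' : y \notin [:: t2; t1; v; p].
      by apply: contra yn; rewrite !inE => /or4P[]->; rewrite ?orbT.
    rewrite -Ep; apply/idP/idP.
      exact: (@twins e' t1 t2 p v y g' emax' e'12 e'1p n2p' h n1v' pt2 v1 yn).
    exact: (@twins e' t2 t1 v p y g' (max' _ emax') e'21 h n1v' e'1p n2p' v1 pt2 yn').
  split.
    have p'n : p' \notin [:: t1; t2; p; v].
      by rewrite !inE !negb_or; repeat (apply/andP; split); neq.
    have p't2 : p' != t2 by rewrite eq_sym.
    by rewrite (tw p' p'n) (Ev p' p't2 p'x) sym (WP v vC) (WE v vC).
  move=> y yC yx yv; have /and4P[y1 y2 yp yp'] := CP y yC.
  have yn : y \notin [:: t1; t2; p; v].
    by rewrite !inE !negb_or; repeat (apply/andP; split); neq.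
  by rewrite (WE y yC) (tw y yn) (Ev y y2 yx).
(* Such an edge makes v adjacent to all of W; for w in W the edge vw, read in the
   other direction, then contradicts what the first switch says about p and p'. *)
have noR v x : v \notin C -> ~~ W v -> v != q -> x \notin C -> ~~ W x -> e x v -> False.
  move=> vC nWv vq xC nWx xv.
  have [A B] := outsider v x xC vC xv nWx vq.
  have [w Ww wq] : exists2 w, W w & w != q.
    apply: contrapT => no; move: W2; rewrite ltnNge => /negP; apply.
    rewrite -(card1 q); apply: subset_leq_card; apply/fintype.subsetP => w Ww.
    by apply: contrapT => /negP wq; apply: no; exists w.
  have wC : w \notin C by case/andP: Ww.
  have wx : w != x by apply: contraTneq Ww => ->.
  have wv : w != v by apply: contraTneq Ww => ->.
  have vw : e v w by rewrite -B.
  by have [] := outsider w v vC wC vw nWv wq; rewrite A Ww (negbTE nWv).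
have offC z x : z \notin C -> z != q -> ~~ W z -> e z x -> x \notin C.
  move=> zC zq nWz zx; apply: contra nWz => xC; move: zx; rewrite sym => /(CW _ _ xC).
  by rewrite (negbTE zC) (negbTE zq).
(* A vertex elsewhere would have all its neighbours in W, like p and p'. *)
have noZ z : z \notin C -> (z == q) || W z.
  move=> zC; apply: contraT; rewrite negb_or => /andP[zq nWz].
  have /and4P[_ _ zp zp'] := CP z zC.
  have := dge z; rewrite -de leqNgt => /negP; case; rewrite ltnS.
  apply: (@nbr_common e z p p' [pred y | e z y] ge); first by distinct.
  move=> w /= zw; have wC := offC z w zC zq nWz zw; rewrite zw /= WP // andbb.
  apply: contraT => npw; case: (noR z w) => //; last by rewrite sym.
  by rewrite /= (negbTE npw).
have cover : #|V| <= 4 + #|[predU1 q & W]|.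
  have := card_size (C ++ enum [predU1 q & W]); rewrite size_cat -cardE; apply: leq_trans.
  apply: subset_leq_card; apply/fintype.subsetP => z _; rewrite mem_cat mem_enum.
  by have [//|/noZ] := boolP (z \in C).
have card_del x : #|W| <= #|[pred y | W y && (y != x)]|.+1.
  have -> : #|[pred y | W y && (y != x)]| = #|[predD1 W & x]|.
    by apply: eq_card => y; rewrite !inE andbC.
  by rewrite (cardD1 x W); case: (x \in W); rewrite ?add1n ?add0n.
have W4 : 3 < #|W|.
  by have := leq_trans n9 cover; rewrite cardS; case: (W q); rewrite ?add0n ?add1n ?add4n // => /ltnW.
have Wdel x : 2 < #|[pred y | W y && (y != x)]|.
  by rewrite -ltnS; apply: leq_trans W4 (card_del x).
have tri a (P : pred V) : uniq [:: p; p'; a] -> 2 < #|P| ->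
    (forall w, P w -> W w && e a w) -> False.
  move=> ua P3 h; have : #|P| <= 2; last by rewrite leqNgt P3.
  apply: (nbr_common ge ua) => w /h /andP[Ww aw].
  by have /andP[pw wC] := Ww; rewrite aw WP // pw.
have [qC qp qp'] : [/\ q \notin C, q != p & q != p'].
  by rewrite !inE !negb_or; split; [repeat (apply/andP; split)| |]; neq.
have dg z : 2 < deg e z by rewrite de.
have WC w : W w -> w \notin C by case/andP.
(* If q is not in W, a neighbour v of q in W is adjacent to the rest of W, and
   p, p', v have three common neighbours. *)
have [Wq|nWq] := boolP (W q); last first.
  have npq : ~~ e p q by rewrite -WE.
  have [v qv] := @nbr_out _ e q [:: t1; t2] (dg q).
  rewrite !in_cons in_nil orbF negb_or => /andP[v1 v2].
  have vp : v != p by apply: contraNneq npq => <-; rewrite sym.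
  have vp' : v != p' by apply: contraNneq npq => E; rewrite -WP // sym -E.
  have vC : v \notin C by rewrite !inE !negb_or v1 v2 vp vp'.
  have vq : v != q by rewrite eq_sym (adj_neq ge.1 qv).
  have Wv : W v by have := noZ v vC; rewrite (negbTE vq).
  have [_ B] := outsider v q qC vC qv nWq vq.
  apply: (tri v [pred y | W y && (y != v)] _ (Wdel v)); first by distinct.
  move=> w /andP[Ww wv]; rewrite Ww -B ?WC //.
  by apply: contraTneq Ww => ->.
have pq' : e p q by rewrite -WE.
have [w [w' [Ww Ww' [wq w'q ww']]]] :
    exists w w', [/\ W w, W w' & [/\ w != q, w' != q & e w w']].
  apply: contrapT => no; apply: (tri q [pred y | W y && (y != q)] _ (Wdel q)); first by distinct.
  move=> w /andP[Ww wq]; rewrite Ww /= sym.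
  have [x wx] := @nbr_out _ e w [:: p; p'] (dg w).
  rewrite !in_cons in_nil orbF negb_or => /andP[xp xp'].
  have wC := WC w Ww; have /and4P[w1 w2 wp wp'] := CP w wC.
  have xt1 : x != t1.
    by apply: contraTneq wx => ->; rewrite sym N1 !inE !negb_or w2 wp wq.
  have xt2 : x != t2.
    by apply: contraTneq wx => ->; rewrite sym N2 !inE !negb_or w1 wp' wq.
  have xC : x \notin C by rewrite !inE !negb_or xt1 xt2 xp xp'.
  have [<- //|xq] := eqVneq x q; case: no; exists w, x; split=> //.
  by have := noZ x xC; rewrite (negbTE xq).
have wC := WC w Ww; have /and4P[w1 w2 wp wp'] := CP w wC.
have w'C := WC w' Ww'; have /and4P[w'1 w'2 w'p w'p'] := CP w' w'C.
have [pw pw'] : e p w /\ e p w' by rewrite -!WE.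
have n1w : ~~ e t1 w by rewrite N1 !inE !negb_or w2 wp wq.
have n1w' : ~~ e t1 w' by rewrite N1 !inE !negb_or w'2 w'p w'q.
have n2w' : ~~ e t2 w' by rewrite N2 !inE !negb_or w'1 w'p' w'q.
have t1w : t1 != w by neq.
have t2w' : t2 != w' by neq.
have wnw' := adj_neq ge.1 ww'.
(* The edges t1t2 and t1p are moved onto w and w', after which t1, p and p' have the
   common neighbours q, w and w'. *)
have gA := switch_same_degrees ge e12 ww' n1w n2w' t1w t2w'.
have [_ _ [A1 A2] _ EA] := switchP ge.1 e12 ww' n1w n2w' t1w t2w'.
set eA := switch _ _ _ _ _ in gA A1 A2 EA.
have EAp x y : x \in [:: p; p'] -> eA x y = e x y.
  by rewrite !inE => /orP[] /eqP->; apply: EA; decide_eq.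
have A1p : eA t1 p by rewrite gA.1.1 EAp ?inE ?eqxx // sym.
have Aw' : eA w' t2 by rewrite gA.1.1.
have An1 : ~~ eA t1 w' by rewrite EA //; decide_eq.
have Anp : ~~ eA p t2 by rewrite EAp ?inE ?eqxx // sym.
have t1w' : t1 != w' by neq.
have pt2 : p != t2 by neq.
have gB := switch_same_degrees gA A1p Aw' An1 Anp t1w' pt2.
have [_ _ [B1 _] _ EB] := switchP gA.1 A1p Aw' An1 Anp t1w' pt2.
set eB := switch _ _ _ _ _ in gB B1 EB.
have Bp y : y != t1 -> y != t2 -> eB p y = e p y.
  by move=> y1 y2; rewrite EB ?EAp ?inE ?eqxx //; decide_eq.
have Bp' y : eB p' y = e p' y.
  by rewrite EB ?EAp ?inE ?eqxx ?orbT //; decide_eq.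
have B1q : eB t1 q.
  by rewrite EB ?EA ?N1 ?inE ?eqxx ?orbT //; decide_eq.
have B1w : eB t1 w by rewrite EB //; decide_eq.
have /and4P[q1 q2 _ _] := CP q qC.
apply: (nK gB); apply: (@K33_intro3 _ _ t1 p p' q w w'); try by distinct.
- by rewrite B1q B1w B1.
- by rewrite !Bp // pq' pw pw'.
by rewrite !Bp' !WP // pq' pw pw'.
Qed.

(** After making t1 and t2 adjacent, three cases according to the number of common
    neighbours; if there are two, they separate t1 and t2 from the rest. *)
Theorem two_cubic t1 t2 : t1 != t2 -> deg e0 t1 = 3 -> deg e0 t2 = 3 ->
  (exists e, same_degrees e) -> False.
Proof.
move=> t12 d1 d2 ex.
have {}ex : exists e, same_degrees e /\ e t1 t2.
  apply: contrapT => no; apply: (@far_false t1 t2) => // e ge; apply/negP => h.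
  by apply: no; exists e.
have [|e [[ge e12] emax]] := @ex_maximal _ _ (fun e => common e t1 t2) #|V| ex.
  by move=> e; exact: max_card.
have cmax : common_max e t1 t2 by move=> e' g' h; apply: emax.
have [[sym irr] de] := ge.
have [||r [ur sr N1]] := @nbrs_ext _ e t1 [:: t2]; [by []|by rewrite /= e12|].
have [||r' [ur' sr' N2]] := @nbrs_ext _ e t2 [:: t1]; [by []|by rewrite /= sym e12|].
move: sr sr' ur ur' N1 N2; rewrite !de d1 d2.
case: r => [|p [|q []]] //= _; case: r' => [|p' [|q' []]] //= _.
rewrite !inE !negb_or => /and3P[/andP[t2p t2q] pq _] /and3P[/andP[t1p' t1q'] pq' _] N1 N2.
have t1n w : e t1 w -> t1 != w := @adj_neq _ e t1 w ge.1.
have t1p : t1 != p by apply: t1n; rewrite N1 !inE eqxx orbT.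
have t1q : t1 != q by apply: t1n; rewrite N1 !inE eqxx !orbT.
have t2n w : e t2 w -> t2 != w := @adj_neq _ e t2 w ge.1.
have t2p' : t2 != p' by apply: t2n; rewrite N2 !inE eqxx orbT.
have t2q' : t2 != q' by apply: t2n; rewrite N2 !inE eqxx !orbT.
have one a b c d : uniq [:: a; b] -> uniq [:: c; d] ->
    (forall w, e t1 w = (w \in [:: t2; a; b])) ->
    (forall w, e t2 w = (w \in [:: t1; c; d])) ->
    t1 != a -> t1 != b -> t1 != c -> t1 != d ->
    t2 != a -> t2 != b -> t2 != c -> t2 != d ->
    b = d -> a != c -> False.
  move=> uab ucd Na Nc ? ? ? ? ? ? ? ? bd ac; subst d.
  move: uab ucd; rewrite /= !inE !andbT => ab cb.
  by apply: (common1_false ge cmax _ Na Nc); distinct.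
have swap a b t w : (w \in [:: t; a; b]) = (w \in [:: t; b; a]).
  by rewrite !inE; case: (w == t); case: (w == a); case: (w == b).
have N1' w : e t1 w = (w \in [:: t2; q; p]) by rewrite N1 swap.
have N2' w : e t2 w = (w \in [:: t1; q'; p']) by rewrite N2 swap.
have same : (forall w, (w \in [:: p'; q']) = (w \in [:: p; q])) -> False.
  move=> E; have [z] : exists z, z \notin [:: t1; t2; p; q].
    by apply: fresh; apply: leq_trans n9.
  rewrite (in_cons t1) (in_cons t2) !negb_or => /and3P[z1 z2 zpq].
  apply: (@cut_small e (mem [:: t1; t2]) (mem [:: p; q]) t1 z ge).
  - exact: (card_size [:: p; q]).
  - by rewrite /= inE eqxx.
  - by rewrite /= !inE negb_or t1p t1q.
  - by rewrite /= !inE negb_or z1 z2.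
  - by rewrite /= !inE negb_or; case/and3P: zpq => -> ->.
  move=> u w /=; rewrite !inE => /orP[] /eqP->.
    by rewrite N1 inE => /orP[->|]; rewrite ?orbT // !inE => ->; rewrite orbT.
  by rewrite N2 inE E => /orP[->|]; rewrite ?orbT // !inE => ->; rewrite orbT.
have upq : uniq [:: p; q] by rewrite /= inE pq.
have uqp : uniq [:: q; p] by rewrite /= inE eq_sym pq.
have upq' : uniq [:: p'; q'] by rewrite /= inE pq'.
have uqp' : uniq [:: q'; p'] by rewrite /= inE eq_sym pq'.
have [E|pp'] := eqVneq p p'.
  have [F|qq'] := eqVneq q q'; first by apply: same => w; rewrite E F.
  exact: (one q p q' p').
have [E|pq''] := eqVneq p q'.
  have [F|qp'] := eqVneq q p'; first by apply: same => w; rewrite E F !inE orbC.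
  exact: (one q p p' q').
have [E|qp'] := eqVneq q p'; first exact: (one p q q' p').
have [E|qq'] := eqVneq q q'; first exact: (one p q p' q').
apply: (common0_false ge cmax _ N1 N2); have t12' := t12; distinct.
Qed.

End TwoCubic.

(** * At most one vertex of degree three *)

Section Vertices.
Variable V : finType.
Implicit Types (e : rel V) (s : seq V) (v x y : V).

(** Vertices are deleted by removing their edges, so that all graphs of the induction
    have the same vertex type. *)
Definition isolate v e : rel V := fun x y => [&& e x y, x != v & y != v].

Definition attach v s e : rel V := fun x y =>
  [|| e x y, (x == v) && (y \in s) | (y == v) && (x \in s)].

Lemma simple_isolate v e : simple e -> simple (isolate v e).
Proof.
move=> [sym irr]; split=> [x y|x]; rewrite /isolate ?irr //.
by rewrite sym [_ && (y != v)]andbC.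
Qed.

Lemma simple_attach v s e : v \notin s -> simple e -> simple (attach v s e).
Proof.
move=> vs [sym irr]; split=> [x y|x]; rewrite /attach; first by rewrite sym [_ && _ || _]orbC.
by rewrite irr orbb /=; apply: contraNF vs => /andP[/eqP->].
Qed.

Lemma deg_isolate0 v e : deg (isolate v e) v = 0.
Proof. by apply: eq_card0 => y; rewrite !inE /isolate eqxx andbF. Qed.

Lemma deg_isolate v e x : simple e -> x != v -> deg (isolate v e) x + e v x = deg e x.
Proof.
move=> [sym _] xv; rewrite /deg [RHS](cardD1 v) addnC inE sym; congr (_ + _).
by apply: eq_card => y; rewrite !inE /isolate xv andbC.
Qed.

Lemma deg0_nadj e v : deg e v = 0 -> forall x, ~~ e v x.
Proof. by move=> /card0_eq h x; have := h x; rewrite !inE => ->. Qed.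

Lemma deg_attach e v s x : simple e -> deg e v = 0 -> uniq s -> v \notin s ->
  deg (attach v s e) x = if x == v then size s else deg e x + count_mem x s.
Proof.
move=> [sym _] /deg0_nadj v0 us vs; rewrite /deg /attach.
have [->|xv] := eqVneq x v.
  rewrite -(card_uniqP us); apply: eq_card => y.
  rewrite !inE (negbTE (v0 y)) (negbTE vs) andbF orbF /=.
  by have [->|] := eqVneq y v.
rewrite count_uniq_mem // [LHS](cardD1 v) addnC !inE eqxx sym (negbTE (v0 x)) /=.
congr (_ + _); apply: eq_card => y; rewrite !inE /=.
have [->|yv] /= := eqVneq y v; first by rewrite sym (negbTE (v0 x)).
by rewrite orbF.
Qed.

Lemma K33_sub e e' A B : allrel e A B -> (forall a b, a \in A -> b \in B -> e a b -> e' a b) ->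
  allrel e' A B.
Proof. by move=> /allrelP h sub; apply/allrelP => a b aA bB; apply: sub => //; apply: h. Qed.

Lemma count_mem_sum x y s : count_mem x (y :: s) = (x == y) + count_mem x s.
Proof. by rewrite /= eq_sym. Qed.

(** Nine active vertices leave three outside the six vertices of a K33, at least one of
    them not in F; its edges do not belong to the K33, and one of them avoids F. *)
Lemma free_edge e A B F : simple e -> size A = 3 -> size B = 3 -> size F <= 2 ->
  8 < #|[pred x | 0 < deg e x]| -> (forall x, 0 < deg e x -> 3 <= deg e x) ->
  exists a b, [/\ e a b, a \notin A ++ B, a \notin F & b \notin F].
Proof.
move=> se sA sB sF act dge.
have [a] : exists a, (0 < deg e a) && (a \notin A ++ B ++ F).
  apply/existsP; apply: contraTT act => /existsPn no; rewrite -leqNgt.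
  have := card_size (A ++ B ++ F); rewrite !size_cat sA sB => h.
  apply: leq_trans (subset_leq_card _) (leq_trans h _); last by rewrite !leq_add2l.
  by apply/fintype.subsetP => x; rewrite inE => dx; have := no x; rewrite dx negbK.
rewrite catA mem_cat negb_or => /and3P[da aAB aF].
have [b ab bF] := @nbr_out _ e a F (leq_ltn_trans sF (dge a da)).
by exists a, b.
Qed.

Lemma flip_allrel e A B a b : allrel e A B -> a \notin A ++ B -> allrel (flip a b e) A B.
Proof.
move=> h; rewrite mem_cat negb_or => /andP[aA aB]; apply: K33_sub h _ => x y xA yB.
have xa : x != a by apply: contraNneq aA => <-.
have ya : y != a by apply: contraNneq aB => <-.
by rewrite /flip (negbTE xa) (negbTE ya) andbF addbF.
Qed.

Lemma attach_allrel e A B v s : allrel e A B -> allrel (attach v s e) A B.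
Proof. by move=> h; apply: K33_sub h _ => x y _ _ xy; rewrite /attach xy. Qed.

Definition K33able e := exists e', [/\ simple e', deg e' =1 deg e & K33 e'].

Definition num_active e := #|[pred x | 0 < deg e x]|.

Definition few_cubic e := (forall x, 0 < deg e x -> 3 <= deg e x) /\
  (forall x y, deg e x = 3 -> deg e y = 3 -> x = y).

End Vertices.

Section Step.
Variables (V : finType) (e0 : rel V).
Implicit Types (e : rel V) (a b p q r s u v w x y z : V).
Hypothesis n10 : 10 <= num_active e0.
Hypothesis dns : few_cubic e0.
Hypothesis IH : forall e, simple e -> num_active e = (num_active e0).-1 ->
  few_cubic e -> K33able e.
Hypothesis nK : forall e, same_degrees e0 e -> ~ K33 e.

Lemma active_isolate (e1 : rel V) v : 0 < deg e0 v -> deg e1 v = 0 ->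
  (forall x, x != v -> (0 < deg e1 x) = (0 < deg e0 x)) -> num_active e1 = (num_active e0).-1.
Proof.
move=> dv d1 h; rewrite /num_active [in RHS](cardD1 v) inE dv add1n /=.
apply: eq_card => x; rewrite !inE; have [->|xv] := eqVneq x v; first by rewrite d1.
by rewrite h.
Qed.

Lemma nbr_active e x y : same_degrees e0 e -> e x y -> 0 < deg e0 y.
Proof.
move=> [[sym _] de] xy; rewrite -de; apply/card_gt0P; exists x.
by rewrite inE sym.
Qed.

(** If v can be deleted without creating a second vertex of degree 3, a K33 for the
    new degrees remains when v is joined to its old neighbours. *)
Lemma reduce0 e v : same_degrees e0 e -> 0 < deg e0 v ->
  (forall x, e v x -> 4 <= deg e0 x) ->
  (forall x y, x != v -> y != v -> deg e0 x - e v x = 3 -> deg e0 y - e v y = 3 -> x = y) ->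
  False.
Proof.
move=> ge dv d4 d3; have [se de] := ge.
have dd x : x != v -> deg (isolate v e) x = deg e0 x - e v x.
  by move=> xv; rewrite -de -(deg_isolate se xv) addnK.
have [||e' [se' de' [A [B [[uA uB] sA sB AB]]]]] := IH (simple_isolate v se).
- apply: (@active_isolate _ v) => //; first exact: deg_isolate0.
  move=> x xv; rewrite dd //; case: (boolP (e v x)) => [/d4|_]; rewrite ?subn0 //.
  by case: (deg e0 x) => [|[]].
- split=> x.
    have [->|xv] := eqVneq x v; first by rewrite deg_isolate0.
    rewrite dd //; case: (boolP (e v x)) => [/d4|_]; first by rewrite subn1; case: (deg e0 x).
    by rewrite subn0; exact: dns.1.
  move=> y; have [->|xv] := eqVneq x v; first by rewrite deg_isolate0.
  have [->|yv] := eqVneq y v; first by rewrite deg_isolate0.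
  by rewrite !dd //; exact: d3.
have [s [us ss sP]] := nbrsP e v.
have vs : v \notin s by rewrite -sP se.2.
have v0 : deg e' v = 0 by rewrite de' deg_isolate0.
apply: (@nK (attach v s e')); last first.
  by exists A, B; split=> //; exact: attach_allrel.
split; first exact: simple_attach.
move=> x; rewrite deg_attach //; have [->|xv] := eqVneq x v; first by rewrite ss de.
by rewrite de' count_uniq_mem // -sP deg_isolate // de.
Qed.

(** Here v is deleted and its nonadjacent neighbours p and q are joined, so that only
    the vertices of t lose a degree.  To put v back, a free edge is subdivided by v. *)
Lemma reduce1 e v p q (t : seq V) : same_degrees e0 e -> uniq [:: p, q & t] -> size t <= 2 ->
  (forall w, e v w = (w \in [:: p, q & t])) -> ~~ e p q ->
  (forall x, x \in t -> 4 <= deg e0 x) ->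
  (forall x y, x != v -> y != v -> deg e0 x - (x \in t) = 3 ->
     deg e0 y - (y \in t) = 3 -> x = y) -> False.
Proof.
move=> ge u st N npq d4 d3; have [se de] := ge.
have pq : p != q by move: u; rewrite /= inE negb_or => /and3P[/andP[]].
have ut : uniq t by move: u => /and3P[].
have vN : v \notin [:: p, q & t] by rewrite -N se.2.
have [vp vq vt] : [/\ v != p, v != q & v \notin t].
  by move: vN; rewrite !in_cons !negb_or => /and3P[].
pose e1 := flip p q (isolate v e).
have sd := simple_isolate v se.
have s1 : simple e1 := simple_flip pq sd.
have npq' : ~~ isolate v e p q by rewrite /isolate (negbTE npq).
have v1 : deg e1 v = 0 by rewrite deg_add // deg_isolate0 (negbTE vp) (negbTE vq).
have dd x : x != v -> deg e1 x + (x \in t) = deg e0 x.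
  move=> xv; rewrite deg_add // -de -(deg_isolate se xv) N !in_cons -!addnA; congr (_ + _).
  move: u; rewrite /= inE negb_or.
  move=> /and3P[/andP[_ pt] qt _].
  have [->|xp] := eqVneq x p; first by rewrite (negbTE pq) (negbTE pt).
  by have [->|xq] := eqVneq x q; rewrite ?(negbTE qt).
have dd' x : x != v -> deg e1 x = deg e0 x - (x \in t) by move=> xv; rewrite -dd // addnK.
have dns1 : few_cubic e1.
  split=> x.
    have [->|xv] := eqVneq x v; first by rewrite v1.
    rewrite dd' //; case: (boolP (x \in t)) => [/d4|_]; last by rewrite subn0; exact: dns.1.
    by rewrite subn1; case: (deg e0 x).
  move=> y; have [->|xv] := eqVneq x v; first by rewrite v1.
  have [->|yv] := eqVneq y v; first by rewrite v1.
  by rewrite !dd' //; exact: d3.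
have vact : 0 < deg e0 v.
  by rewrite -de; apply/card_gt0P; exists p; rewrite inE N inE eqxx.
have act1 : num_active e1 = (num_active e0).-1.
  apply: (@active_isolate _ v) => // x xv; rewrite dd' //.
  case: (boolP (x \in t)) => [/d4|_]; last by rewrite subn0.
  by case: (deg e0 x) => [|[]].
have [e' [se' de' [A [B [[uA uB] sA sB AB]]]]] := IH s1 act1 dns1.
have [|x|a [b [ab aAB aF bF]]] := @free_edge _ e' A B t se' sA sB st.
- have -> : #|[pred x | 0 < deg e' x]| = num_active e1 by apply: eq_card => x; rewrite !inE de'.
  by rewrite act1 -ltnS prednK // (leq_trans _ n10).
- by rewrite de'; exact: dns1.1.
have v0 : deg e' v = 0 by rewrite de'.
have anb := adj_neq se' ab.
have va : v != a by apply: contraTneq ab => <-; exact: deg0_nadj.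
have vb : v != b by apply: contraTneq ab => <-; rewrite se'.1; exact: deg0_nadj.
have s2 : simple (flip a b e') := simple_flip anb se'.
have v2 : deg (flip a b e') v = 0.
  by have := deg_rem v se' ab; rewrite v0 (negbTE va) (negbTE vb) !addn0.
have us : uniq [:: a, b & t] by rewrite /= inE negb_or anb aF bF.
have vs : v \notin [:: a, b & t] by rewrite !in_cons !negb_or va vb.
apply: (@nK (attach v [:: a, b & t] (flip a b e'))); last first.
  by exists A, B; split=> //; apply/attach_allrel/flip_allrel.
split; first exact: simple_attach.
move=> x; rewrite deg_attach //; have [->|xv] := eqVneq x v.
  have -> : size [:: a, b & t] = size [:: p, q & t] by [].
  by rewrite -(card_uniqP u) -de; apply: eq_card => w; rewrite [in RHS]inE N.
by rewrite !count_mem_sum !addnA deg_rem // de' count_uniq_mem // dd.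
Qed.

(** Two pairs of neighbours are joined, no degree changes, and v is put back by
    subdividing two disjoint free edges. *)
Lemma reduce2 e v p q r s : same_degrees e0 e -> uniq [:: p; q; r; s] ->
  (forall w, e v w = (w \in [:: p; q; r; s])) -> ~~ e p q -> ~~ e r s -> False.
Proof.
move=> ge u N npq nrs; have [se de] := ge.
have vN : v \notin [:: p; q; r; s] by rewrite -N se.2.
move: (u); rewrite /= !inE !negb_or => /and4P[/and3P[pq pr ps] /andP[qr qs] rs _].
have [vp vq vr vs] : [/\ v != p, v != q, v != r & v != s].
  by move: vN; rewrite !inE !negb_or => /and4P[].
have sd := simple_isolate v se.
have npq' : ~~ isolate v e p q by rewrite /isolate (negbTE npq).
pose e1 := flip p q (isolate v e); have s1 : simple e1 := simple_flip pq sd.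
have nrs' : ~~ e1 r s by rewrite /e1 /flip /isolate (negbTE nrs); decide_eq.
pose e2 := flip r s e1; have s2 : simple e2 := simple_flip rs s1.
have v2 : deg e2 v = 0 by rewrite !deg_add // deg_isolate0; decide_eq.
have dd x : x != v -> deg e2 x = deg e0 x.
  move=> xv; rewrite !deg_add // -de -(deg_isolate se xv) N !inE -!addnA; congr (_ + _).
  have [->|xp] := eqVneq x p; first by decide_eq.
  have [->|xq] := eqVneq x q; first by decide_eq.
  by have [->|xr] := eqVneq x r; first by decide_eq.
have dns2 : few_cubic e2.
  split=> x.
    by have [->|xv] := eqVneq x v; [rewrite v2|rewrite dd //; exact: dns.1].
  move=> y; have [->|xv] := eqVneq x v; first by rewrite v2.
  have [->|yv] := eqVneq y v; first by rewrite v2.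
  by rewrite !dd //; exact: dns.2.
have vact : 0 < deg e0 v.
  by rewrite -de; apply/card_gt0P; exists p; rewrite inE N inE eqxx.
have act2 : num_active e2 = (num_active e0).-1 by apply: (@active_isolate _ v) => // x xv; rewrite dd.
have [e' [se' de' [A [B [[uA uB] sA sB AB]]]]] := IH s2 act2 dns2.
have act' : 8 < #|[pred x | 0 < deg e' x]|.
  have -> : #|[pred x | 0 < deg e' x]| = num_active e2 by apply: eq_card => x; rewrite !inE de'.
  by rewrite act2 -ltnS prednK // (leq_trans _ n10).
have dge' x : 0 < deg e' x -> 3 <= deg e' x by rewrite de'; exact: dns2.1.
have [a [b [ab aAB _ _]]] := @free_edge _ e' A B [::] se' sA sB isT act' dge'.
have [c [d [cd cAB cF dF]]] := @free_edge _ e' A B [:: a; b] se' sA sB isT act' dge'.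
move: cF dF; rewrite !inE !negb_or => /andP[ca cb] /andP[da db].
have v0 : deg e' v = 0 by rewrite de'.
have out x y : e' x y -> v != x /\ v != y.
  move=> xy; split; apply: contraTneq xy => <-; last rewrite se'.1; exact: deg0_nadj.
have [va vb] := out a b ab; have [vc vd] := out c d cd.
have anb := adj_neq se' ab; have cnd := adj_neq se' cd.
have s3 : simple (flip a b e') := simple_flip anb se'.
have cd3 : flip a b e' c d by rewrite /flip cd; decide_eq.
have s4 : simple (flip c d (flip a b e')) := simple_flip cnd s3.
have us : uniq [:: c; d; a; b] by distinct.
have vL : v \notin [:: c; d; a; b] by rewrite !in_cons !negb_or va vb vc vd.
have E3 x := deg_rem x se' ab; have E4 x := deg_rem x s3 cd3.
have v4 : deg (flip c d (flip a b e')) v = 0.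
  by have := E4 v; have := E3 v; rewrite v0; decide_eq; rewrite !addn0 => ->.
apply: (@nK (attach v [:: c; d; a; b] (flip c d (flip a b e')))); last first.
  by exists A, B; split=> //; apply/attach_allrel/flip_allrel => //; apply: flip_allrel.
split; first exact: simple_attach.
move=> x; rewrite deg_attach //; have [->|xv] := eqVneq x v.
  have -> : size [:: c; d; a; b] = size [:: p; q; r; s] by [].
  by rewrite -(card_uniqP u) -de; apply: eq_card => w; rewrite [in RHS]inE N.
by rewrite !count_mem_sum !addnA E4 E3 de' dd // addn0.
Qed.

Lemma deg_ge e x (t : seq V) : uniq t -> all (e x) t -> size t <= deg e x.
Proof.
move=> us /allP h; rewrite -(card_uniqP us); apply: subset_leq_card.
by apply/fintype.subsetP => y; exact: h.
Qed.

Lemma fresh_active (s : seq V) : size s < num_active e0 ->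
  exists2 z, 0 < deg e0 z & z \notin s.
Proof.
move=> h; apply: contrapT => no; move: h; apply/negP; rewrite -leqNgt.
apply: leq_trans (card_size s); apply: subset_leq_card; apply/fintype.subsetP => z.
rewrite inE => dz; apply: contrapT => /negP zs; apply: no; by exists z.
Qed.

Section LoneCubic.
Variable v0 : V.
Hypothesis d0 : deg e0 v0 = 3.

Lemma not_cubic x : 0 < deg e0 x -> x != v0 -> 3 < deg e0 x.
Proof.
move=> dx xv; rewrite ltn_neqAle dns.1 // andbT.
by apply: contraNneq xv => h; apply/eqP/dns.2.
Qed.

(** A nonadjacent pair in N(v0) would allow reducing v0: the third neighbour has degree
    at least 4 and may become the new vertex of degree 3. *)
Lemma lone_clique e p q : same_degrees e0 e -> e v0 p -> e v0 q -> p != q -> e p q.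
Proof.
move=> ge vp vq pq; apply: contrapT => /negP npq; have [se de] := ge.
have [||t [ut st N]] := @nbrs_ext _ e v0 [:: p; q].
- by rewrite /= inE pq.
- by rewrite /= vp vq.
move: st ut N; rewrite de d0; case: t => [|z []] //= _ u N.
have vz : e v0 z by rewrite N !inE eqxx !orbT.
have zv : z != v0 by rewrite eq_sym (adj_neq se vz).
have only x : x != v0 -> deg e0 x - (x \in [:: z]) = 3 -> x = z.
  move=> xv; rewrite inE; have [//|xz] := eqVneq x z; rewrite subn0 => dx.
  by case/eqP: xv; apply: dns.2.
apply: (@reduce1 e v0 p q [:: z] ge u isT N npq) => [x|x y xv yv dx dy].
  by rewrite inE => /eqP->; apply: not_cubic zv; exact: nbr_active vz.
by rewrite (only x) // (only y).
Qed.

(** After the switch of v0m and ab the vertex a belongs to N(v0), which is a clique. *)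
Lemma lone_link e m a b : same_degrees e0 e -> e v0 m -> ~~ e v0 a -> ~~ e v0 b ->
  a != v0 -> b != v0 -> e a b -> ~~ e m b ->
  forall m', e v0 m' -> m' != m -> e a m'.
Proof.
move=> ge vm nva nvb av bv ab nmb m' vm' mm'; have [se de] := ge.
have va : v0 != a by rewrite eq_sym.
have mb : m != b := nadj_neq vm nvb.
have ma : m != a := nadj_neq vm nva.
have m'a : m' != a := nadj_neq vm' nva.
have m'b : m' != b := nadj_neq vm' nvb.
have m'v : m' != v0 by rewrite eq_sym (adj_neq se vm').
have ab' := adj_neq se ab.
have g' := switch_same_degrees ge vm ab nva nmb va mb.
have [_ _ [h _] _ E] := switchP se vm ab nva nmb va mb.
have := lone_clique g' h; move/(_ m'); rewrite !E; first by apply; rewrite // eq_sym.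
all: by decide_eq.
Qed.

(** Call a vertex full if it is adjacent to all of N(v0).  Together with v0, two
    full vertices give K33. *)
Lemma lone_full e w w' : same_degrees e0 e -> w != v0 -> w' != v0 -> w != w' ->
  (forall m, e v0 m -> e w m) -> (forall m, e v0 m -> e w' m) -> False.
Proof.
move=> ge wv w'v ww' hw hw'; apply: (nK ge).
apply: (@K33_intro _ _ v0 w w' [pred m | e v0 m]); first by distinct.
  by have -> : #|[pred m | e v0 m]| = 3 := etrans (ge.2 v0) d0.
by move=> m /= vm; rewrite vm hw // hw'.
Qed.

Lemma two_nbrs e b (s : seq V) : same_degrees e0 e -> b != v0 -> 0 < deg e0 b -> size s <= 2 ->
  exists a a', [/\ e b a, e b a', a != a', a \notin s & a' \notin s].
Proof.
move=> ge bv db ss; have d4 := not_cubic db bv; rewrite -ge.2 in d4.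
have [a ba aS] := @nbr_out _ e b s (leq_ltn_trans ss (ltnW d4)).
have [a' ba'] := @nbr_out _ e b (a :: s) (leq_ltn_trans (ss : size (a :: s) <= 3) d4).
by rewrite in_cons negb_or => /andP[aa' a'S]; exists a, a'; split; rewrite // eq_sym.
Qed.

Lemma lone_third e m m' : same_degrees e0 e -> e v0 m -> e v0 m' -> m != m' ->
  exists m'', [/\ e v0 m'', uniq [:: m; m'; m''] &
    forall w, e v0 w = (w \in [:: m; m'; m''])].
Proof.
move=> ge vm vm' mm'; have [||t [ut st N]] := @nbrs_ext _ e v0 [:: m; m'].
- by rewrite /= inE mm'.
- by rewrite /= vm vm'.
move: st ut N; rewrite ge.2 d0; case: t => [|z []] //= _ u N.
by exists z; split=> //; rewrite N !inE eqxx !orbT.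
Qed.

(** If b misses two vertices of N(v0), its other neighbours are full, and there are two
    of them. *)
Lemma lone_miss1 e b m m' : same_degrees e0 e -> b != v0 -> ~~ e v0 b -> 0 < deg e0 b ->
  e v0 m -> e v0 m' -> m != m' -> ~~ e b m -> e b m'.
Proof.
move=> ge bv nvb db vm vm' mm' nbm; apply: contrapT => /negP nbm'.
have [sym irr] := ge.1; have [m'' [vm'' u N]] := lone_third ge vm vm' mm'.
have [a [a' [ba ba' aa']]] := @two_nbrs e b [:: m''] ge bv db isT.
rewrite !inE => am am'.
have full c : e b c -> c != m'' -> c != v0 /\ forall k, e v0 k -> e c k.
  move=> bc cm; have cv : c != v0 by apply: contraTneq bc => ->; rewrite sym.
  have nvc : ~~ e v0 c.
    by rewrite N !inE !negb_or cm andbT !(nadj_neq bc).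
  split=> // k vk; have cb : e c b by rewrite sym.
  rewrite sym in nbm; rewrite sym in nbm'.
  have [->|km] := eqVneq k m; last exact: (lone_link ge vm nvc nvb cv bv cb nbm).
  exact: (lone_link ge vm' nvc nvb cv bv cb nbm').
have [av fa] := full a ba am; have [a'v fa'] := full a' ba' am'.
exact: (lone_full ge av a'v aa').
Qed.

(** Two neighbours of b elsewhere are not both full, and by the previous lemmas one of
    them misses the same vertex as b. *)
Lemma lone_partner e b m : same_degrees e0 e -> b != v0 -> ~~ e v0 b -> 0 < deg e0 b ->
  e v0 m -> ~~ e b m -> exists a, [/\ e b a, a != v0, ~~ e v0 a & ~~ e a m].
Proof.
move=> ge bv nvb db vm nbm; have [sym irr] := ge.1.
have d3 : 2 < deg e v0 by rewrite ge.2 d0.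
have [m' vm'] := @nbr_out _ e v0 [:: m] (ltnW d3); rewrite inE eq_sym => mm'.
have [m'' [vm'' u N]] := lone_third ge vm vm' mm'.
have [a [a' [ba ba' aa']]] := @two_nbrs e b [:: m'; m''] ge bv db isT.
rewrite !inE !negb_or => /andP[am' am''] /andP[a'm' a'm''].
apply: contrapT => no.
have full c : e b c -> c != m' -> c != m'' -> c != v0 /\ forall k, e v0 k -> e c k.
  move=> bc cm cm'; have cv : c != v0 by apply: contraTneq bc => ->; rewrite sym.
  have nvc : ~~ e v0 c by rewrite N !inE !negb_or cm cm' andbT (nadj_neq bc).
  split=> // k vk; have cb : e c b by rewrite sym.
  have nmb : ~~ e m b by rewrite sym.
  have [->|km] := eqVneq k m; last exact: (lone_link ge vm nvc nvb cv bv cb nmb).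
  by apply: contrapT => /negP ncm; apply: no; exists c.
have [av fa] := full a ba am' am''; have [a'v fa'] := full a' ba' a'm' a'm''.
exact: (lone_full ge av a'v aa').
Qed.

(** If b misses m and c misses m', then b and its partner a are not adjacent to c; the
    switch of ba and mc makes c miss both m and m'. *)
Lemma lone_type e b c m m' : same_degrees e0 e -> b != v0 -> ~~ e v0 b -> 0 < deg e0 b ->
  c != v0 -> ~~ e v0 c -> 0 < deg e0 c ->
  e v0 m -> e v0 m' -> ~~ e b m -> ~~ e c m' -> m = m'.
Proof.
move=> ge bv nvb db cv nvc dc vm vm' nbm ncm'; apply: contrapT => /eqP mm'.
have [se de] := ge; have [sym irr] := se; have m'm : m' != m by rewrite eq_sym.
have [a [ba av nva nam]] := lone_partner ge bv nvb db vm nbm.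
have cm : e c m := lone_miss1 ge cv nvc dc vm' vm m'm ncm'.
have cross k : k != v0 -> ~~ e v0 k -> ~~ e k m -> ~~ e c k.
  move=> kv nvk nkm; apply/negP => ck; rewrite sym in nkm.
  by have := lone_link ge vm nvc nvk cv kv ck nkm vm' m'm; rewrite (negbTE ncm').
have ncb := cross b bv nvb nbm; have nca := cross a av nva nam.
have mc : e m c by rewrite sym.
have nac : ~~ e a c by rewrite sym.
have bm : b != m by apply: contraNneq nvb => ->.
have am : a != m by apply: contraNneq nva => ->.
have cb : c != b by apply: contraTneq cm => ->.
have ac : a != c by apply: contraTneq cm => <-.
have mnc := adj_neq se mc; have bna := adj_neq se ba.
have m'a : m' != a by apply: contraNneq nva => <-.
have m'b : m' != b by apply: contraNneq nvb => <-.
have vm_ : v0 != m := adj_neq se vm.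
have m'v : v0 != m' := adj_neq se vm'.
have g' := switch_same_degrees ge ba mc nbm nac bm ac.
have [_ _ _ [_ h] E] := switchP se ba mc nbm nac bm ac.
have E0 w : switch b a m c e v0 w = e v0 w by apply: E; decide_eq.
have h' : ~~ switch b a m c e c m by rewrite g'.1.1.
have : switch b a m c e c m'.
  by apply: lone_miss1 g' cv _ dc _ _ _ h'; rewrite ?E0 // eq_sym.
by rewrite E ?(negbTE ncm') //; decide_eq.
Qed.

(** All vertices elsewhere are adjacent to y and z and all but one, w, miss x.  So
    N(x) = {v0, y, z, w}; by the absence of K33 the vertex w has a single further neighbour
    a, and it can be deleted after joining x and a, since y and z have large
    degrees. *)
Lemma lone_false : (exists e, same_degrees e0 e) -> False.
Proof.
move=> [e ge]; have [se de] := ge; have [sym irr] := se.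
have [k1 [k2 [k3 [uk Nk]]]] := nbrs3 (etrans (de v0) d0).
have vact x : e v0 x -> 0 < deg e0 x by exact: nbr_active.
have [b1 db1] := @fresh_active [:: v0; k1; k2; k3] (leq_trans (isT : 4 < 10) n10).
rewrite in_cons negb_or -Nk => /andP[b1v nvb1].
have [b2 db2] := @fresh_active [:: b1; v0; k1; k2; k3] (leq_trans (isT : 5 < 10) n10).
rewrite in_cons negb_or => /andP[b21]; rewrite in_cons negb_or -Nk => /andP[b2v nvb2].
have [b [x [bv nvb db vx nbx]]] : exists b x,
    [/\ b != v0, ~~ e v0 b, 0 < deg e0 b, e v0 x & ~~ e b x].
  apply: contrapT => no; apply: (lone_full ge b2v b1v b21) => m vm;
    apply: contrapT => /negP nm; apply: no; [by exists b2, m|by exists b1, m].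
have d3 : 2 < deg e v0 by rewrite de d0.
have [y vy] := @nbr_out _ e v0 [:: x] (ltnW d3); rewrite inE eq_sym => xy.
have [z [vz u N]] := lone_third ge vx vy xy.
move: (u); rewrite /= !inE negb_or => /and3P[/andP[_ xz] yz _].
have all_yz o m : o != v0 -> ~~ e v0 o -> 0 < deg e0 o -> e v0 m -> x != m -> e o m.
  move=> ov nvo do_ vm xm; apply: contrapT => /negP nom; case/eqP: xm.
  exact: (lone_type ge bv nvb db ov nvo do_ vx vm nbx nom).
have xv : x != v0 by rewrite eq_sym (adj_neq se vx).
have yv : y != v0 by rewrite eq_sym (adj_neq se vy).
have zv : z != v0 by rewrite eq_sym (adj_neq se vz).
have exy := lone_clique ge vx vy xy; have exz := lone_clique ge vx vz xz.
have eyz := lone_clique ge vy vz yz.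
have dx4 := not_cubic (vact x vx) xv.
have [w xw] := @nbr_out _ e x [:: v0; y; z] ltac:(by rewrite de).
rewrite !inE !negb_or => /and3P[wv wy wz].
have wx : w != x by rewrite eq_sym (adj_neq se xw).
have nvw : ~~ e v0 w by rewrite N !inE !negb_or wx wy wz.
have dw : 0 < deg e0 w := nbr_active ge xw.
have wfull m : e v0 m -> e w m.
  move=> vm; have [<-|xm] := eqVneq x m; first by rewrite sym.
  exact: all_yz.
have nfull o : o != v0 -> ~~ e v0 o -> 0 < deg e0 o -> o != w -> ~~ e o x.
  move=> ov nvo do_ ow; apply/negP => ox; apply: (lone_full ge ov wv ow) => // m vm.
  by have [<-//|xm] := eqVneq x m; apply: all_yz.
have dw4 := not_cubic dw wv.
have [a wa] := @nbr_out _ e w [:: x; y; z] ltac:(by rewrite de).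
rewrite !inE !negb_or => /and3P[ax ay az].
have wO c : e w c -> c \notin [:: x; y; z] -> [/\ c != v0, ~~ e v0 c, 0 < deg e0 c & c != w].
  move=> wc cx; split; [|by rewrite N|exact: nbr_active wc|by rewrite eq_sym (adj_neq se wc)].
  by apply: contraTneq wc => ->; rewrite sym.
have aN : a \notin [:: x; y; z] by rewrite !inE !negb_or ax ay az.
have [av nva da aw] := wO a wa aN.
have nxa : ~~ e x a by rewrite sym nfull.
have [ey ez] : e a y /\ e a z by split; apply: all_yz.
have Nw c : e w c = (c \in [:: x; a; y; z]).
  apply/idP/idP => [wc|]; last first.
    by rewrite !inE => /or4P[] /eqP->; rewrite ?wa ?wfull.
  apply: contraT; rewrite !inE !negb_or => /and4P[cx ca cy cz].
  have cN : c \notin [:: x; y; z] by rewrite !inE !negb_or cx cy cz.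
  have [cv nvc dc cw] := wO c wc cN.
  case: (nK ge); apply: (@K33_intro3 _ _ y z w x a c); try by distinct.
  - by rewrite ![e y _]sym exy ey (all_yz c y).
  - by rewrite ![e z _]sym exz ez (all_yz c z).
  by rewrite wa wc sym xw.
have big m m' : e v0 m -> e v0 m' -> m != m' -> x != m -> x != m' -> 4 < deg e0 m.
  move=> vm vm' mm' xm xm'; rewrite -de.
  have am : a != m by apply: contraNneq nva => ->.
  have wm : w != m by apply: contraNneq nvw => ->.
  have am' : a != m' by apply: contraNneq nva => ->.
  have wm' : w != m' by apply: contraNneq nvw => ->.
  have mv : v0 != m' := adj_neq se vm'.
  apply: (@deg_ge e m [:: v0; x; m'; w; a]); first by distinct.
  have m'm : m' != m by rewrite eq_sym.
  have exm : e x m := lone_clique ge vx vm xm.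
  have em'm : e m' m := lone_clique ge vm' vm m'm.
  by rewrite /= ![e m _]sym vm exm em'm (wfull m vm) (all_yz a m).
have uw : uniq [:: x; a; y; z] by distinct.
have d5 c : c \in [:: y; z] -> 4 < deg e0 c.
  by rewrite !inE => /orP[] /eqP->; [apply: (big y z)|apply: (big z y); rewrite // eq_sym].
have only c : c != w -> deg e0 c - (c \in [:: y; z]) = 3 -> c = v0.
  move=> cw; case: (boolP (c \in _)) => [/d5|_]; last by rewrite subn0 => dc; apply: dns.2.
  by rewrite subn1; case: (deg e0 c) => [|[|[|[|[]]]]].
apply: (@reduce1 e w x a [:: y; z] ge uw isT Nw nxa) => [c /d5 /ltnW //|c c' cw c'w dc dc'].
by rewrite (only c) // (only c').
Qed.

End LoneCubic.

Section NoCubic.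
Hypothesis d4 : forall x, 0 < deg e0 x -> 3 < deg e0 x.

Lemma nbrs_full e x (t : seq V) : uniq t -> all (e x) t -> size t = deg e x ->
  forall w, e x w = (w \in t).
Proof.
move=> ut xt st w; have [r [_ sr N]] := nbrs_ext ut xt.
move: sr N; rewrite -st => /eqP; rewrite -{2}[size t]addn0 eqn_add2l.
by case: r => // _ N; rewrite N cats0.
Qed.

Section AtFour.
Variable v : V.
Hypothesis dv : deg e0 v = 4.

(** Otherwise v could be deleted after joining p with q and r with s. *)
Lemma four_match e p q r s : same_degrees e0 e -> uniq [:: p; q; r; s] ->
  all (e v) [:: p; q; r; s] -> e p q || e r s.
Proof.
move=> ge u a; apply: contrapT => /negP; rewrite negb_or => /andP[n1 n2].
by apply: (reduce2 ge u (nbrs_full u a _) n1 n2); rewrite ge.2 dv.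
Qed.

(** Otherwise v could be deleted after joining p and q, with at most one new vertex of
    degree 3. *)
Lemma four_rest e p q r s : same_degrees e0 e -> uniq [:: p; q; r; s] ->
  all (e v) [:: p; q; r; s] -> ~~ e p q -> deg e0 r = 4 /\ deg e0 s = 4.
Proof.
move=> ge u a npq.
have N := nbrs_full u a (esym (etrans (ge.2 v) dv)).
have act x : x \in [:: r; s] -> 3 < deg e0 x.
  move=> xr; apply: d4; apply: (nbr_active ge (_ : e v x)).
  by rewrite N in_cons in_cons xr !orbT.
have key x y : x \in [:: r; s] -> (forall z, z \in [:: r; s] -> z != x -> z = y) -> deg e0 x = 4.
  move=> xrs only; apply: contrapT => dx.
  apply: (@reduce1 e v p q [:: r; s] ge u isT N npq act) => z z' _ _.
  have three c : deg e0 c - (c \in [:: r; s]) = 3 -> c = y.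
    case: (boolP (c \in _)) => [crs|_].
      rewrite subn1 => dc; apply: only => //; apply: contra_notN dx => /eqP<-.
      by move: dc; case: (deg e0 c) => [|n] //= ->.
    by rewrite subn0 => dc; have := @d4 c; rewrite dc => /(_ isT).
  by move=> /three-> /three->.
split.
  by apply: (key r s) => [|z]; rewrite !inE ?eqxx // => /orP[] /eqP->; rewrite ?eqxx.
by apply: (key s r) => [|z]; rewrite !inE ?eqxx ?orbT // => /orP[] /eqP->; rewrite ?eqxx.
Qed.

(** Otherwise v could be deleted without joining any of its neighbours. *)
Lemma four_two e : same_degrees e0 e -> exists r s,
  [/\ e v r, e v s, r != s & deg e0 r = 4 /\ deg e0 s = 4].
Proof.
move=> ge; apply: contrapT => no.
have three x : x != v -> deg e0 x - e v x = 3 -> e v x /\ deg e0 x = 4.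
  move=> xv; case: (e v x); last first.
    by rewrite subn0 => dx; have := @d4 x; rewrite dx => /(_ isT).
  by rewrite subn1; case: (deg e0 x) => // n /= ->.
apply: (@reduce0 e v ge) => [|x vx|x y xv yv /three[]// vx dx /three[]// vy dy].
- by rewrite dv.
- exact/d4/(nbr_active ge vx).
apply: contrapT => /eqP xy; apply: no; exists x, y.
by split; rewrite // eq_sym.
Qed.

Definition outer e o := [/\ 0 < deg e0 o, o != v & ~~ e v o].

Lemma outerN e p q r s o : (forall w, e v w = (w \in [:: p; q; r; s])) -> outer e o ->
  [/\ o != p, o != q, o != r & o != s].
Proof. by move=> N [_ _]; rewrite N !inE !negb_or => /and4P[]. Qed.

Lemma outer_nbr e o (t : seq V) : same_degrees e0 e -> outer e o -> size t <= 3 ->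
  (forall w, e v w -> e o w -> w \in t) -> exists a, [/\ e o a, outer e a & a \notin t].
Proof.
move=> ge [do_ ov nvo] st h.
have [a oa aS] := @nbr_out _ e o t ltac:(by rewrite ge.2; exact: leq_ltn_trans st (d4 do_)).
exists a; split=> //; split.
- exact: nbr_active ge oa.
- by apply: contraTneq oa => ->; rewrite ge.1.1.
by apply: contra aS => va; apply: h.
Qed.

Lemma outer_fresh e (t : seq V) : same_degrees e0 e -> size t <= 4 ->
  exists o, outer e o /\ o \notin t.
Proof.
move=> ge st; have [s [us ss sP]] := nbrsP e v.
have [ o do_] := @fresh_active (v :: s ++ t) ltac:(rewrite /= size_cat ss ge.2 dv;
  by apply: leq_trans n10; rewrite !ltnS; exact: leq_add (leqnn 4) st).
rewrite in_cons mem_cat !negb_or -sP => /and3P[ ov nvo ot].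
by exists o.
Qed.

(** The switch that replaces the neighbour x of v by the outer vertex a. *)
Lemma four_switch e x a b : same_degrees e0 e -> e v x -> outer e a -> outer e b -> e a b ->
  ~~ e x b -> let e' := switch v x a b e in
  [/\ same_degrees e0 e', e' v a & forall y z, y != v -> y != x -> y != a -> y != b ->
     e' y z = e y z /\ e' z y = e z y].
Proof.
move=> ge vx [da av nva] [db bv nvb] ab nxb e'.
have va : v != a by rewrite eq_sym.
have xb := nadj_neq vx nvb.
have g' := switch_same_degrees ge vx ab nva nxb va xb.
have [_ _ [h _] _ E] := switchP ge.1 vx ab nva nxb va xb.
by split=> // y z yv yx ya yb; split; apply: E; decide_eq.
Qed.

Lemma all_adj4 e p q r s : (forall w, e v w = (w \in [:: p; q; r; s])) ->
  [/\ e v p, e v q, e v r & e v s].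
Proof. by move=> N; rewrite !N !inE !eqxx !orbT. Qed.

(** The neighbours of r are v and the other neighbours of v.  Moving the edge vr to an
    outer vertex a turns s and a into a pair opposite to the nonadjacent pair p, q,
    so s is adjacent to a; thus s is adjacent to every outer vertex, although its degree
    is 4. *)
Lemma four_hub e p q r s : same_degrees e0 e -> uniq [:: p; q; r; s] ->
  (forall w, e v w = (w \in [:: p; q; r; s])) ->
  ~~ e p q -> e r p -> e r q -> e r s -> False.
Proof.
move=> ge u N npq rp rq rs; have [se de] := ge; have [sym irr] := se.
have [vp vq vr vs] := all_adj4 N.
have [dr ds] := four_rest ge u ltac:(by rewrite /= vp vq vr vs) npq.
move: (u); rewrite /= !inE !negb_or => /and4P[/and3P[pq pr ps] /andP[qr qs] rs' _].
have [vp' vq' vr' vs'] : [/\ v != p, v != q, v != r & v != s].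
  by split; apply: (adj_neq se).
have Nr : forall w, e r w = (w \in [:: v; p; q; s]).
  apply: nbrs_full; first by distinct.
    by rewrite /= [e r v]sym vr rp rq rs.
  by rewrite de dr.
have out_r o : outer e o -> ~~ e r o.
  move=> oo; have [ op oq _ os] := outerN N oo; have [_ ov _] := oo.
  by rewrite Nr !inE !negb_or ov op oq os.
have s_all o : outer e o -> e s o.
  move=> oo; have [w vw ow|b [ ob oob _]] := @outer_nbr e o [:: p; q; s] ge oo isT.
    have wr : w != r by apply: contraTneq ow => ->; rewrite sym; exact: out_r.
    by move: vw; rewrite N !inE (negbTE wr).
  have nrb := out_r b oob; have [ op oq or os] := outerN N oo.
  have [bp bq br bs] := outerN N oob; have [_ ov _] := oo; have [_ bv _] := oob.
  have [g' va E] := four_switch ge vr oo oob ob nrb.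
  have := @four_match _ p q s o g'; rewrite (E p q _ _ _ _).1 ?(E s o _ _ _ _).1; try by neq.
  rewrite (negbTE npq) /=; apply; first by distinct.
  by rewrite /= va !(E _ v _ _ _ _).2 ?vp ?vq ?vs //; neq.
have [ o1 [ oo1 _]] := @outer_fresh e [::] ge isT.
have [ o2 [ oo2 o21]] := @outer_fresh e [:: o1] ge isT.
have [ o3 [ oo3 o3n]] := @outer_fresh e [:: o1; o2] ge isT.
move: o21 o3n; rewrite !inE negb_or => o21 /andP[ o31 o32].
have : 5 <= deg e s.
  have [ o1p o1q o1r o1s] := outerN N oo1; have [ o2p o2q o2r o2s] := outerN N oo2.
  have [ o3p o3q o3r o3s] := outerN N oo3.
  have [_ o1v _] := oo1; have [_ o2v _] := oo2; have [_ o3v _] := oo3.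
  apply: (@deg_ge e s [:: v; r; o1; o2; o3]); first by distinct.
  by rewrite /= [e s v]sym [e s r]sym vs rs !s_all.
by rewrite de ds.
Qed.

(** Here q is isolated in N(v) and p, r, s form a triangle of vertices of degree 4.  For
    an outer vertex b not adjacent to p and an outer neighbour a of b, the edge vp can be
    moved to a, so r is adjacent to a.  As r has room for one outer neighbour only, b has
    degree at most 3. *)
Lemma four_star e p q r s : same_degrees e0 e -> uniq [:: p; q; r; s] ->
  (forall w, e v w = (w \in [:: p; q; r; s])) ->
  ~~ e p q -> ~~ e q r -> ~~ e q s -> e p r -> e p s -> e r s -> False.
Proof.
move=> ge u N npq nqr nqs pr ps rs; have [se de] := ge; have [sym irr] := se.
have [vp vq vr vs] := all_adj4 N.
have [dr ds] := four_rest ge u ltac:(by rewrite /= vp vq vr vs) npq.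
move: (u); rewrite /= !inE !negb_or => /and4P[/and3P[pq pr' ps'] /andP[qr qs] rs' _].
have uq : uniq [:: q; r; p; s] by distinct.
have [dp _] := four_rest ge uq ltac:(by rewrite /= vp vq vr vs) nqr.
have [vp' vq' vr' vs'] : [/\ v != p, v != q, v != r & v != s].
  by split; apply: (adj_neq se).
have [b [ ob npb]] : exists b, outer e b /\ ~~ e p b.
  have [ o1 [ oo1 _]] := @outer_fresh e [::] ge isT.
  have [ o2 [ oo2]] := @outer_fresh e [:: o1] ge isT; rewrite inE => o21.
  have [h1|] := boolP (e p o1); last by exists o1.
  have [h2|] := boolP (e p o2); last by exists o2.
  have [ o1p o1q o1r o1s] := outerN N oo1; have [ o2p o2q o2r o2s] := outerN N oo2.
  have [_ o1v _] := oo1; have [_ o2v _] := oo2.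
  have : 5 <= deg e p; last by rewrite de dp.
  apply: (@deg_ge e p [:: v; r; s; o1; o2]); first by distinct.
  by rewrite /= [e p v]sym vp pr ps h1 h2.
have [bp bq br bs] := outerN N ob; have [_ bv _] := ob.
have r_nbr a : e b a -> outer e a -> e r a.
  move=> ba oa; have ab : e a b by rewrite sym.
  have [ap aq ar as'] := outerN N oa; have [_ av _] := oa.
  have [g' va E] := four_switch ge vp oa ob ab npb.
  have := @four_match _ q s r a g'; rewrite (E q s _ _ _ _).1 ?(E r a _ _ _ _).1; try by neq.
  rewrite (negbTE nqs) /=; apply; first by distinct.
  by rewrite /= va !(E _ v _ _ _ _).2 ?vq ?vr ?vs //; neq.
have nbp w : e b w -> w != p by move=> bw; apply: contraTneq bw => ->; rewrite sym.
have [w vw bw|a [ba oa _]] := @outer_nbr e b [:: q; r; s] ge ob isT.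
  by move: vw; rewrite N !inE (negbTE (nbp w bw)).
have [ap aq ar as'] := outerN N oa; have [_ av _] := oa.
have Nr : forall w, e r w = (w \in [:: v; p; s; a]).
  apply: nbrs_full; first by distinct.
    by rewrite /= [e r v]sym [e r p]sym vr pr rs (r_nbr a).
  by rewrite de dr.
have nbr : ~~ e b r.
  by rewrite sym Nr !inE !negb_or bv bp bs /=; apply: contraTneq ba => ->; rewrite irr.
have : deg e b <= 3; last first.
  by rewrite leqNgt de d4 //; case: ob.
apply: (@deg_sub _ e b [:: q; s; a]) => w bw.
have wr := nadj_neq bw nbr; have wp := nbp w bw.
have [vw|nvw] := boolP (e v w).
  by move: vw; rewrite N !inE (negbTE wr) (negbTE wp) /= => /orP[]->; rewrite ?orbT.
have ow : outer e w.
  split=> //; first exact: nbr_active bw.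
  by apply: contraTneq bw => ->; rewrite sym; case: ob.
have := r_nbr w bw ow; rewrite Nr !inE (negbTE wp).
have [_ /negbTE-> _] := ow; have [_ _ _ /negbTE->] := outerN N ow.
by move=> /= /eqP->; rewrite eqxx !orbT.
Qed.

(** Moving the edge vr to an outer vertex a shows that p and q have degree 4 too, so v
    and its neighbours are a component.  Moving also vp to an outer vertex c leaves the
    nonadjacent pairs q, a and s, c in the neighbourhood of v. *)
Lemma four_clique e p q r s : same_degrees e0 e -> uniq [:: p; q; r; s] ->
  (forall w, e v w = (w \in [:: p; q; r; s])) -> deg e0 r = 4 -> deg e0 s = 4 ->
  [&& e p q, e p r, e p s, e q r, e q s & e r s] -> False.
Proof.
move=> ge u N dr ds /and5P[pq pr ps qr /andP[qs rs]].
have [se de] := ge; have [sym irr] := se.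
have [vp vq vr vs] := all_adj4 N.
move: (u); rewrite /= !inE !negb_or => /and4P[/and3P[pq' pr' ps'] /andP[qr' qs'] rs' _].
have [vp' vq' vr' vs'] : [/\ v != p, v != q, v != r & v != s].
  by split; apply: (adj_neq se).
have Nr : forall w, e r w = (w \in [:: v; p; q; s]).
  apply: nbrs_full; first by distinct.
    by rewrite /= [e r v]sym [e r p]sym [e r q]sym vr pr qr rs.
  by rewrite de dr.
have Ns : forall w, e s w = (w \in [:: v; p; q; r]).
  apply: nbrs_full; first by distinct.
    by rewrite /= [e s v]sym [e s p]sym [e s q]sym [e s r]sym vs ps qs rs.
  by rewrite de ds.
have out_r o : outer e o -> ~~ e r o.
  move=> oo; have [ op oq _ os] := outerN N oo; have [_ ov _] := oo.
  by rewrite Nr !inE !negb_or ov op oq os.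
have out_s o : outer e o -> ~~ e s o.
  move=> oo; have [ op oq or _] := outerN N oo; have [_ ov _] := oo.
  by rewrite Ns !inE !negb_or ov op oq or.
have [a [ oa _]] := @outer_fresh e [::] ge isT.
have [w vw aw|b [ab ob _]] := @outer_nbr e a [:: p; q] ge oa isT.
  have wr : w != r by apply: contraTneq aw => ->; rewrite sym; exact: out_r.
  have ws : w != s by apply: contraTneq aw => ->; rewrite sym; exact: out_s.
  by move: vw; rewrite N !inE (negbTE wr) (negbTE ws) !orbF.
have [ap aq ar as'] := outerN N oa; have [_ av nva] := oa.
have [bp bq br bs] := outerN N ob; have [_ bv nvb] := ob.
have [g' va E] := four_switch ge vr oa ob ab (out_r b ob).
set e' := switch v r a b e in g' va E.
have [Ep Eq Es] : [/\ e' v p, e' v q & e' v s].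
  by rewrite !(E _ v _ _ _ _).2 //; neq.
have u' : uniq [:: s; a; p; q] by distinct.
have nsa : ~~ e' s a by rewrite (E s a _ _ _ _).1; [exact: out_s| | | |]; neq.
have [dp dq] := four_rest g' u' ltac:(by rewrite /= va Ep Eq Es) nsa.
have Np : forall w, e p w = (w \in [:: v; q; r; s]).
  apply: nbrs_full; first by distinct.
    by rewrite /= [e p v]sym vp pq pr ps.
  by rewrite de dp.
have Nq : forall w, e q w = (w \in [:: v; p; r; s]).
  apply: nbrs_full; first by distinct.
    by rewrite /= [e q v]sym [e q p]sym vq pq qr qs.
  by rewrite de dq.
have out_p o : outer e o -> ~~ e p o.
  move=> oo; have [_ oq or os] := outerN N oo; have [_ ov _] := oo.
  by rewrite Np !inE !negb_or ov oq or os.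
have out_q o : outer e o -> ~~ e q o.
  move=> oo; have [ op _ or os] := outerN N oo; have [_ ov _] := oo.
  by rewrite Nq !inE !negb_or ov op or os.
have [c [ oc]] := @outer_fresh e [:: a; b] ge isT; rewrite !inE negb_or => /andP[ca cb].
have [w vw cw|f [cf of' ]] := @outer_nbr e c [:: a; b] ge oc isT.
  move: cw; rewrite sym; move: vw; rewrite N !inE => /or4P[] /eqP->; apply: contraTT => _.
  - exact: out_p.
  - exact: out_q.
  - exact: out_r.
  exact: out_s.
rewrite !inE negb_or => /andP[fa fb].
have [cp cq cr cs] := outerN N oc; have [dc cv nvc] := oc.
have [fp fq fr fs] := outerN N of'; have [df fv nvf] := of'.
have oc' : outer e' c by split; rewrite // (E c v _ _ _ _).2.
have of'' : outer e' f by split; rewrite // (E f v _ _ _ _).2.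
have cf' : e' c f by rewrite (E c f _ _ _ _).1.
have npf : ~~ e' p f by rewrite (E f p _ _ _ _).2 // out_p.
have [g'' vc E'] := four_switch g' Ep oc' of'' cf' npf.
set e'' := switch v p c f e' in g'' vc E'.
have u'' : uniq [:: q; a; s; c] by distinct.
have := @four_match e'' q a s c g'' u''.
rewrite (E' q a _ _ _ _).1 ?(E' s c _ _ _ _).1; try by neq.
rewrite (E q a _ _ _ _).1 ?(E s c _ _ _ _).1; try by neq.
rewrite (negbTE (out_q a oa)) (negbTE (out_s c oc)) /= => /(_ _) h.
suff : false by []; apply: h.
by rewrite vc !(E' _ v _ _ _ _).2 ?Eq ?va ?Es //; neq.
Qed.

(** If N(v) is not a clique, a nonadjacent pair p, q and the conditions on the two
    perfect matchings that cross it leave only the cases of a hub and of a star. *)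
Lemma four_false : (exists e, same_degrees e0 e) -> False.
Proof.
move=> [e ge]; have [se de] := ge; have [sym irr] := se.
have [p0 [q0 [vp0 vq0 pq0 [dp0 dq0]]]] := four_two ge.
have ext p q : e v p -> e v q -> p != q -> exists r s,
    uniq [:: p; q; r; s] /\ (forall w, e v w = (w \in [:: p; q; r; s])).
  move=> vp vq pq; have [||t [ut st N]] := @nbrs_ext _ e v [:: p; q].
  - by rewrite /= inE pq.
  - by rewrite /= vp vq.
  move: st ut N; rewrite de dv; case: t => [|r [|s []]] //= _ ut N.
  by exists r, s.
have adj p q : e v p -> e v q -> p != q -> e p q.
  move=> vp vq pq; apply: contrapT => /negP npq.
  have [r [s [u N]]] := ext p q vp vq pq; have [_ _ vr vs] := all_adj4 N.
  have a : all (e v) [:: p; q; r; s] by rewrite /= vp vq vr vs.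
  move: (u); rewrite /= !inE !negb_or => /and4P[/and3P[_ pr ps] /andP[qr qs] rs _].
  have ers : e r s by have := four_match ge u a; rewrite (negbTE npq).
  have esr : e s r by rewrite sym.
  have uB : uniq [:: p; q; s; r] by distinct.
  have NB w : e v w = (w \in [:: p; q; s; r]).
    by rewrite N !inE; congr [|| _, _ | _]; rewrite orbC.
  have uC : uniq [:: q; p; r; s] by distinct.
  have NC w : e v w = (w \in [:: q; p; r; s]) by rewrite N !inE orbCA.
  have nqp : ~~ e q p by rewrite sym.
  have u1 : uniq [:: p; r; q; s] by distinct.
  have u2 : uniq [:: p; s; q; r] by distinct.
  have := @four_match e p r q s ge u1; rewrite /= vp vq vr vs => /(_ isT).
  have := @four_match e p s q r ge u2; rewrite /= vp vq vr vs => /(_ isT).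
  have hubr : e p r -> e q r -> False.
    by move=> pr' qr'; apply: (four_hub ge u N npq); rewrite // sym.
  have hubs : e p s -> e q s -> False.
    by move=> ps' qs'; apply: (four_hub ge uB NB npq); rewrite // sym.
  have [qr'|nqr] := boolP (e q r); have [qs'|nqs] := boolP (e q s);
  have [pr'|npr] := boolP (e p r); have [ps'|nps] := boolP (e p s) => //= _ _;
    try solve [exact: hubr | exact: hubs].
  - by apply: (four_star ge uC NC nqp).
  by apply: (four_star ge u N npq).
have [r [s [u N]]] := ext p0 q0 vp0 vq0 pq0; have [_ _ vr vs] := all_adj4 N.
move: (u); rewrite /= !inE !negb_or => /and4P[/and3P[_ pr ps] /andP[qr qs] rs _].
have u' : uniq [:: r; s; p0; q0] by distinct.
have N' w : e v w = (w \in [:: r; s; p0; q0]).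
  by rewrite N !inE; case: (w == p0); case: (w == q0); case: (w == r); case: (w == s).
apply: (four_clique ge u' N'); rewrite ?de //.
by repeat (apply/andP; split); apply: adj; neq.
Qed.

End AtFour.

(** With no vertex of degree 4 at all, any vertex can be deleted. *)
Lemma no_cubic_false : (exists e, same_degrees e0 e) -> False.
Proof.
move=> ex; have [[v dv]|no] := pselect (exists v, deg e0 v = 4).
  exact: (four_false dv).
have [e ge] := ex; have [v dv _] := @fresh_active [::] (leq_trans (isT : 0 < 10) n10).
have d5 x : 0 < deg e0 x -> 4 < deg e0 x.
  move=> dx; rewrite ltn_neqAle d4 // andbT; apply/eqP => d; by apply: no; exists x.
have three x : deg e0 x - e v x = 3 -> False.
  move=> h; have := @d5 x; move: h; case: (deg e0 x) => // n; case: (e v x).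
    by rewrite subn1 /= => ->; move=> /(_ isT).
  by rewrite subn0 => ->; move=> /(_ isT).
apply: (@reduce0 e v ge dv) => [x vx|x y _ _ /three//].
by apply: ltnW; apply: d5; exact: nbr_active vx.
Qed.

End NoCubic.

Lemma few_cubic_step : (exists e, same_degrees e0 e) -> False.
Proof.
move=> ex; have [[v dv]|no] := pselect (exists v, deg e0 v = 3).
  exact: (lone_false dv).
apply: no_cubic_false ex => x dx; rewrite ltn_neqAle dns.1 // andbT.
by apply/eqP => d; apply: no; exists x.
Qed.

End Step.

(** The step of the induction is [few_cubic_step]; its hypothesis covers graphs on the same
    vertex type with one more isolated vertex. *)
Lemma few_cubic_K33able (V : finType) :
  (forall e : rel V, simple e -> num_active e = 9 -> few_cubic e -> K33able e) ->
  forall e : rel V, simple e -> 9 <= num_active e -> few_cubic e -> K33able e.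
Proof.
move=> base e; move En: (num_active e) => n.
elim: n e En => // n IH e En se; rewrite leq_eqVlt => /orP[/eqP n9|n9] de.
  by apply: base => //; rewrite En -n9.
apply: contrapT => no; apply: (@few_cubic_step V e _ de) => [|e' se' En' de'|e' [se' de'] k|].
- by rewrite En.
- by apply: IH => //; rewrite En' En.
- by apply: no; exists e'.
by exists e.
Qed.

(** * Sequences of at most nine terms *)

Definition gadj (E : seq (nat * nat)) i j := ((i, j) \in E) || ((j, i) \in E).

(** Edges are listed in increasing order of their ends, which excludes loops. *)
Definition realizes n E s :=
  all (fun p => p.1 < p.2) E &&
  (mkseq (fun i => count (gadj E i) (iota 0 n)) n == s).

(** Joins i to the later vertices of largest residual degree. *)
(** A heuristic completion of the edges E to a graph with degrees s that avoids the pairs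
    in forb.  Nothing is proved about it: its output is checked. *)
Definition greedy_step n (forb : rel nat) (st : seq (nat * nat) * seq nat) i :=
  let: (E, r) := st in
  let c := take (nth 0 r i) (sort (fun j k => nth 0 r k <= nth 0 r j)
    [seq j <- iota i.+1 (n - i.+1) | [&& 0 < nth 0 r j, (i, j) \notin E & ~~ forb i j]]) in
  ([seq (i, j) | j <- c] ++ E, mkseq (fun j => nth 0 r j - (j \in c)) n).

Definition greedy (forb : rel nat) (E : seq (nat * nat)) (s : seq nat) :=
  let n := size s in
  (foldl (greedy_step n forb)
     (E, mkseq (fun j => nth 0 s j - count (fun p => (p.1 == j) || (p.2 == j)) E) n)
     (iota 0 n)).1.

(** Positions in the sequence sorted in decreasing order.  The last one is only used for
    the sequence of eight sixes. *)
Definition K33_templates : seq (seq nat * seq nat) :=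
  [:: ([:: 0; 1; 2], [:: 3; 4; 5]); ([:: 0; 2; 4], [:: 1; 3; 5]);
      ([:: 0; 4; 5], [:: 1; 6; 7])].

Definition check_K33 s :=
  has (fun AB => let: (A, B) := AB in let n := size s in
    let E := greedy (fun _ _ => false) [seq (minn a b, maxn a b) | a <- A, b <- B] s in
    [&& realizes n E s, allrel (gadj E) A B & all (fun i => i < n) (A ++ B)])
  K33_templates.

(** Pairs of a separating set and a set that it separates, found by search to suffice for
    at most eight vertices. *)
Definition cut_templates n : seq (seq nat * seq nat) :=
  [:: ([:: 0; 1], [:: n - 3; n - 2; n - 1]); ([:: 0; 1], [:: n - 4; n - 3]);
      ([:: 0; 1], [:: n - 2; n - 1]); ([:: 0; 6], [:: n - 6; n - 5])].

(** The greedy completion avoids the pairs between C and the vertices outside C and T. *)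
Definition check_cut s :=
  has (fun TC => let: (T, C) := TC in let n := size s in
    let E := greedy (fun i j => [&& (i \in C) != (j \in C), i \notin T & j \notin T]) [::] s in
    [&& realizes n E s, has (fun i => (i < n) && (i \notin T)) C,
        has (fun i => (i \notin C) && (i \notin T)) (iota 0 n) &
        all (fun i => all (fun j => gadj E i j ==> (j \in C) || (j \in T)) (iota 0 n)) C])
  (cut_templates (size s)).

Definition erdos_gallai s :=
  ~~ odd (sumn s) &&
  all (fun k => sumn (take k s) <= k * k.-1 + sumn [seq minn k d | d <- drop k s])
    (iota 0 (size s)).

(** All nonincreasing sequences of n numbers between 3 and m. *)
Fixpoint seqs n m : seq (seq nat) :=
  if n is n'.+1 then
    flatten [seq [seq d :: t | t <- seqs n' d] | d <- iota 3 (m - 2)]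
  else [:: [::]].

Definition exceptional : seq (seq nat) :=
  [:: [:: 3; 3; 3; 3]; [:: 4; 4; 4; 4; 4]; [:: 4; 4; 4; 3; 3]; [:: 4; 3; 3; 3; 3];
      [:: 5; 5; 4; 4; 3; 3]; [:: 5; 3; 3; 3; 3; 3]; [:: 4; 4; 4; 4; 4; 4];
      [:: 6; 6; 4; 4; 4; 4; 4]; [:: 6; 5; 5; 5; 3; 3; 3]; [:: 6; 6; 6; 6; 3; 3; 3; 3]].

Lemma nine_checked :
  all (fun s => (count_mem 3 s <= 1) ==> erdos_gallai s ==> check_K33 s) (seqs 9 8).
Proof. by vm_compute. Qed.

Lemma small_checked :
  all (fun n => all (fun s => erdos_gallai s ==>
    [|| check_K33 s, check_cut s | s \in exceptional]) (seqs n n.-1)) (iota 4 5).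
Proof. by vm_compute. Qed.

(** All ways to choose d of the positions with a positive residual degree. *)
Fixpoint choices (ds : seq nat) d : seq bitseq :=
  if ds is x :: ds' then
    [seq false :: b | b <- choices ds' d] ++
    (if (0 < x) && (0 < d) then [seq true :: b | b <- choices ds' d.-1] else [::])
  else if d == 0 then [:: [::]] else [::].

Definition sub_bits ds (b : bitseq) := [seq p.1 - nat_of_bool p.2 | p <- zip ds b].

(** All graphs with degrees ds on the vertices 0, 1, and so on, as lists of rows of the
    upper triangle of the adjacency matrix: the first row is chosen, and the
    residual degrees of the other vertices are realised recursively. *)
Fixpoint realisations n (ds : seq nat) : seq (seq bitseq) :=
  if n is n'.+1 then
    if ds is d :: ds' then
      flatten [seq [seq b :: g | g <- realisations n' (sub_bits ds' b)] | b <- choices ds' d]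
    else [::]
  else [:: [::]].

Definition row_adj (g : seq bitseq) i j :=
  if i < j then nth false (nth [::] g i) (j - i.+1)
  else (j < i) && nth false (nth [::] g j) (i - j.+1).

Definition relabelling n (p : seq nat) g g' :=
  all (fun i => all (fun j => row_adj g i j == row_adj g' (nth 0 p i) (nth 0 p j))
    (iota 0 n)) (iota 0 n).

(** Only degree-preserving permutations are tried. *)
Lemma exceptional_checked : all (fun s => let n := size s in
    let ps := [seq p <- permutations (iota 0 n) | [seq nth 0 s i | i <- p] == s] in
    let gs := realisations n s in
    all (fun g => has (fun p => relabelling n p g (head [::] gs)) ps) gs) exceptional.
Proof. by vm_compute. Qed.

Section Transfer.
Variables (V : finType) (e0 : rel V) (L : seq V).
Hypotheses (s0 : simple e0) (uL : uniq L).
Hypothesis outL : forall x, x \notin L -> deg e0 x = 0.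
Let n := size L.
Let s := [seq deg e0 x | x <- L].

Lemma deg_count (e : rel V) x : (forall y, e x y -> y \in L) -> deg e x = count (e x) L.
Proof.
move=> h; rewrite -size_filter -(card_uniqP (filter_uniq _ uL)).
by apply: eq_card => y; rewrite !inE mem_filter; case: (boolP (e x y)) => // /h.
Qed.

Lemma map_indexL : [seq index x L | x <- L] = iota 0 n.
Proof.
case: L uL @n => // x0 L' u n'; apply: (@eq_from_nth _ 0); first by rewrite size_map size_iota.
move=> i; rewrite size_map => iL; rewrite (nth_map x0) // nth_iota // add0n.
exact: index_uniq.
Qed.

(** The graph E with the number i realised by the i-th vertex of L. *)
Definition transfer E : rel V := fun x y =>
  [&& x \in L, y \in L & gadj E (index x L) (index y L)].

Lemma transfer_same_degrees E : realizes n E s -> same_degrees e0 (transfer E).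
Proof.
move=> /andP[/allP lt /eqP Es].
have sim : simple (transfer E).
  split=> [x y|x]; rewrite /transfer /gadj; first by rewrite andbCA orbC.
  rewrite orbb; apply/negbTE/negP => /and3P[_ _ /lt]; by rewrite /= ltnn.
split=> // x; have [xL|xL] := boolP (x \in L); last first.
  rewrite (outL xL); apply: eq_card0 => y; by rewrite !inE /transfer (negbTE xL).
rewrite deg_count; last by move=> y /and3P[].
have ix : index x L < n by rewrite index_mem.
have -> : deg e0 x = nth 0 s (index x L) by rewrite (nth_map x) // nth_index.
rewrite -Es nth_mkseq // -map_indexL count_map; apply: eq_in_count => y yL.
by rewrite /= /transfer xL yL.
Qed.

Lemma transfer_nth E x0 i j : i < n -> j < n ->
  transfer E (nth x0 L i) (nth x0 L j) = gadj E i j.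
Proof. by move=> iL jL; rewrite /transfer !mem_nth // !index_uniq. Qed.

Lemma check_K33_sound : check_K33 s -> K33able e0.
Proof.
move=> /hasP[[A B] tAB /and3P[real AB lt]]; set E := greedy _ _ _ in real AB.
have sz : size s = n by rewrite size_map.
have [sA sB uA uB] : [/\ size A = 3, size B = 3, uniq A & uniq B].
  by move: tAB; rewrite !inE => /or3P[] /eqP[-> ->].
have [x0 _] : exists x, x \in L.
  move: lt; rewrite sz /n; case: A sA {AB tAB uA E real} => // a A _.
  by case: L => [|x L'] //= _; exists x; rewrite inE eqxx.
rewrite sz in real lt; move: lt; rewrite all_cat => /andP[/allP ltA /allP ltB].
exists (transfer E); have [sT dT] := transfer_same_degrees real; split=> //.
have inj (X : seq nat) : uniq X -> (forall i, i \in X -> i < n) -> uniq [seq nth x0 L i | i <- X].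
  move=> uX ltX; rewrite map_inj_in_uniq // => i j /ltX iL /ltX jL /eqP.
  by rewrite nth_uniq // => /eqP.
exists [seq nth x0 L i | i <- A], [seq nth x0 L i | i <- B].
split; rewrite ?size_map //; first by split; apply: inj.
apply/allrelP => _ _ /mapP[i iA ->] /mapP[j jB ->].
by rewrite (transfer_nth E x0 (ltA i iA) (ltB j jB)) (allrelP AB i j iA jB).
Qed.

Lemma check_cut_sound : (forall x, x \in L) -> check_cut s ->
  exists e, same_degrees e0 e /\ cut e.
Proof.
move=> allL /hasP[[T C] tTC]; have sz : size s = n by rewrite size_map.
rewrite sz => /and4P[real /hasP[i iC /andP[iL iT]] /hasP[j]].
rewrite mem_iota => /andP[_ jL] /andP[jC jT] /allP closed.
set E := greedy _ _ _ in real closed.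
have sT : size T <= 2 by move: tTC; rewrite sz !inE => /or4P[] /eqP[-> _].
have [x0 _] : exists x, x \in L.
  by move: iL; rewrite /n; case: L => [|x L'] //= _; exists x; rewrite inE eqxx.
exists (transfer E); split; first exact: transfer_same_degrees.
exists [seq nth x0 L k | k <- T & k < n], [pred x | index x L \in C], (nth x0 L i), (nth x0 L j).
have memT k : k < n -> (nth x0 L k \in [seq nth x0 L k | k <- T & k < n]) = (k \in T).
  move=> kL; apply/mapP/idP => [[k']|kT].
    rewrite mem_filter => /andP[k'L k'T] /eqP; rewrite nth_uniq // => /eqP->.
    exact: k'T.
  by exists k => //; rewrite mem_filter kL.
split.
- by rewrite size_map size_filter; apply: leq_trans (count_size _ _) sT.
- by rewrite /= index_uniq // iC memT.
- by rewrite /= index_uniq // jC memT.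
move=> u w /= uC /and3P[_ wL uw]; rewrite -(nth_index x0 wL) memT ?index_mem //.
rewrite index_uniq ?index_mem //.
have /allP/(_ (index w L)) := closed _ uC; rewrite mem_iota add0n index_mem wL => /(_ isT).
by rewrite uw.
Qed.

Lemma sum_deg : sumn s = \sum_(x <- L) \sum_(y <- L) e0 x y.
Proof.
rewrite sumnE big_map; apply: eq_big_seq => x xL; rewrite deg_count; last first.
  move=> y xy; apply: contraT => /outL/deg0_nadj/(_ x); by rewrite s0.1 xy.
by rewrite -sumn_count sumnE big_map.
Qed.

Lemma handshake : ~~ odd (sumn s).
Proof.
rewrite sum_deg; elim: L => [|x M IH]; first by rewrite big_nil.
rewrite big_cons big_cons s0.2 add0n.
under [X in _ + X]eq_bigr => y _ do rewrite big_cons s0.1.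
by rewrite big_split /= addnA addnn oddD odd_double.
Qed.

(** The edges at the k first vertices either join two of them, or are counted
    at the other ends, each of which receives at most k of them. *)
Lemma erdos_gallai_nec : erdos_gallai s.
Proof.
rewrite /erdos_gallai handshake /=; apply/allP => k; rewrite mem_iota /= size_map => kn.
rewrite -map_take -map_drop sumnE big_map.
have dL x : deg e0 x = count (e0 x) L.
  apply: deg_count => y xy; apply: contraT => /outL/deg0_nadj/(_ x); by rewrite s0.1 xy.
pose T := take k L; pose D := drop k L.
have sT : size T = k by rewrite size_take kn.
have uT : uniq T by rewrite take_uniq.
have -> : \sum_(x <- T) deg e0 x = \sum_(x <- T) count (e0 x) T + \sum_(x <- T) count (e0 x) D.
  rewrite -big_split /=; apply: eq_bigr => x _.
  by rewrite dL -{1}(cat_take_drop k L) count_cat.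
apply: leq_add.
  have -> : k * k.-1 = \sum_(x <- T) k.-1 by rewrite big_const_seq count_predT sT iter_addn_0 mulnC.
  rewrite big_seq [X in _ <= X]big_seq; apply: leq_sum => x xT.
  have xk : 0 < k by rewrite -sT -has_predT; apply/hasP; exists x.
  rewrite -ltnS prednK // -sT -(count_predC (e0 x) T) -addn1 leq_add2l -has_count.
  by apply/hasP; exists x; rewrite //= s0.2.
rewrite sumnE !big_map.
have -> : \sum_(x <- T) count (e0 x) D = \sum_(y <- D) count (e0 y) T.
  under eq_bigr => x _ do rewrite -sumn_count sumnE big_map.
  rewrite exchange_big /=; apply: eq_bigr => y _; rewrite -sumn_count sumnE big_map.
  by apply: eq_bigr => x _; rewrite s0.1.
apply: leq_sum => y _; rewrite leq_min -{1}sT count_size dL.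
by rewrite -[X in _ <= count _ X](cat_take_drop k L) count_cat leq_addr.
Qed.

End Transfer.

Lemma seqs_mem s m : sorted geq s -> all (fun d => 3 <= d <= m) s -> s \in seqs (size s) m.
Proof.
elim: s m => [|d s IH] m //= ps /andP[/andP[d3 dm] bs].
apply/flatten_mapP; exists d; first by rewrite mem_iota; lia.
apply: map_f; apply: IH; first exact: path_sorted ps.
have tr : transitive geq by move=> x y z h1 h2; exact: leq_trans h2 h1.
move/order_path_min: ps => /(_ tr) /allP ds; apply/allP => c cs.
by have /allP/(_ c cs)/andP[-> _] := bs; exact: ds.
Qed.

(** The nonisolated vertices in order of decreasing degree. *)
Lemma degree_order (V : finType) (e : rel V) : exists L : seq V,
  [/\ uniq L, (forall x, (x \in L) = (0 < deg e x)), size L = num_active e &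
      sorted geq [seq deg e x | x <- L]].
Proof.
exists (sort (fun x y => deg e y <= deg e x) (enum [pred x | 0 < deg e x])).
split.
- by rewrite sort_uniq enum_uniq.
- by move=> x; rewrite mem_sort mem_enum inE.
- by rewrite size_sort /num_active cardE.
rewrite sorted_map; apply: sort_sorted => x y.
exact: leq_total.
Qed.

Lemma deg_lt_active (V : finType) (e : rel V) x :
  simple e -> 0 < deg e x -> deg e x < num_active e.
Proof.
move=> se dx; rewrite /num_active (cardD1 x) inE dx add1n ltnS; apply: subset_leq_card.
apply/fintype.subsetP => y; rewrite !inE => xy; rewrite eq_sym (adj_neq se xy) /=.
by apply/card_gt0P; exists x; rewrite inE se.1.
Qed.

Lemma few_cubic_nine (V : finType) (e : rel V) :
  simple e -> num_active e = 9 -> few_cubic e -> K33able e.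
Proof.
move=> se a9 [d3 d3u]; have [L [uL memL sL srt]] := degree_order e.
have outL x : x \notin L -> deg e x = 0 by rewrite memL -eqn0Ngt => /eqP.
apply: (check_K33_sound uL outL).
set s := [seq deg e x | x <- L] in srt *.
have ss : size s = 9 by rewrite size_map sL.
have bs : all (fun d => 3 <= d <= 8) s.
  apply/allP => _ /mapP[x xL ->]; move: xL; rewrite memL => dx.
  by rewrite d3 //= -ltnS -a9 deg_lt_active.
have := seqs_mem srt bs; rewrite ss => /(allP nine_checked).
have -> : count_mem 3 s <= 1.
  rewrite count_map -size_filter; set M := seq.filter _ _.
  have uM : uniq M by rewrite filter_uniq.
  have : forall x y, x \in M -> y \in M -> x = y.
    by move=> x y; rewrite !mem_filter => /andP[/eqP dx _] /andP[/eqP dy _]; apply: d3u.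
  case: M uM => [|x [|y M]] //= /and3P[]; rewrite inE negb_or => /andP[xy _] _ _ h.
  by case/eqP: xy; apply: h; rewrite !inE eqxx ?orbT.
by rewrite (erdos_gallai_nec se uL outL).
Qed.

(** * Relabelling the realisations of the exceptional sequences *)

Section Rows.
Variable f : rel nat.
Hypotheses (symf : symmetric f) (irrf : irreflexive f).

Lemma choices_map (t : seq nat) (p : pred nat) (D : nat -> nat) :
  (forall j, p j -> 0 < D j) -> [seq p j | j <- t] \in choices [seq D j | j <- t] (count p t).
Proof.
move=> pD; elim: t => //= j t IH; rewrite mem_cat; case: (boolP (p j)) => pj /=.
  by rewrite add1n pD //=; apply/orP; right; exact: map_f.
by apply/orP; left; exact: map_f.
Qed.

Lemma sub_bits_map (t : seq nat) (p : pred nat) (D : nat -> nat) :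
  sub_bits [seq D j | j <- t] [seq p j | j <- t] = [seq D j - p j | j <- t].
Proof. by rewrite /sub_bits; elim: t => //= j t ->. Qed.

Definition rows k m := [seq [seq f i j | j <- iota i.+1 (k + m - i.+1)] | i <- iota k m].

(** The rows of an actual graph are among the enumerated ones. *)
Lemma rows_realisation k m :
  rows k m \in realisations m [seq count (f i) (iota k m) | i <- iota k m].
Proof.
elim: m k => [|m IH] k //=; rewrite irrf add0n.
apply/flatten_mapP; exists [seq f k j | j <- iota k.+1 m].
  apply: (@choices_map _ (f k) (fun i => f i k + count (f i) (iota k.+1 m))) => j.
  by rewrite symf => ->.
rewrite sub_bits_map /rows /= addnS subSS addKn; apply: map_f.
have -> : [seq f j k + count (f j) (iota k.+1 m) - f k j | j <- iota k.+1 m] =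
          [seq count (f i) (iota k.+1 m) | i <- iota k.+1 m].
  by apply: eq_map => j; rewrite symf addKn.
exact: IH.
Qed.

Lemma row_adj_rows n i j : i < n -> j < n -> row_adj (rows 0 n) i j = f i j.
Proof.
have lt a b : a < b -> b < n -> nth false (nth [::] (rows 0 n) a) (b - a.+1) = f a b.
  move=> ab bn; have an := ltn_trans ab bn.
  rewrite (nth_map 0) ?size_iota // nth_iota // !add0n (nth_map 0) ?size_iota; last by lia.
  by rewrite nth_iota; [congr (f _ _)|]; lia.
move=> iN jN; rewrite /row_adj; case: (ltngtP i j) => [ij|ji|<-] /=; first exact: lt.
  by rewrite lt // symf.
by rewrite irrf.
Qed.

End Rows.

(** Every realisation of an exceptional sequence is a relabelling of one fixed list of
    rows, the first one in the enumeration. *)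
Lemma exceptional_rows (V : finType) (e : rel V) (L : seq V) (x0 : V) :
  simple e -> uniq L -> (forall x, x \in L) ->
  let s := [seq deg e x | x <- L] in s \in exceptional ->
  exists2 p, perm_eq p (iota 0 (size L)) & forall x y, e x y =
    row_adj (head [::] (realisations (size s) s)) (nth 0 p (index x L)) (nth 0 p (index y L)).
Proof.
move=> [sym irr] uL allL s sE; have ss : size s = size L by rewrite size_map.
pose f : rel nat := fun i j => e (nth x0 L i) (nth x0 L j).
have fs : symmetric f by move=> i j; rewrite /f sym.
have fi : irreflexive f by move=> i; rewrite /f irr.
have ds : [seq count (f i) (iota 0 (size L)) | i <- iota 0 (size L)] = s.
  rewrite -map_indexL // -map_comp /s; apply: eq_map => x /=.
  rewrite (deg_count uL) // count_map; apply: eq_count => y.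
  by rewrite /= /f !nth_index.
have /allP := allP exceptional_checked s sE.
have rr := rows_realisation fs fi 0 (size L); rewrite ds -{2}ss in rr.
move=> /(_ _ rr) /hasP[p]; rewrite mem_filter mem_permutations => /andP[_ pp] /allP rel.
exists p; first by rewrite -ss.
move=> x y; have xL := allL x; have yL := allL y.
have ix : index x L \in iota 0 (size s) by rewrite mem_iota add0n ss index_mem.
have iy : index y L \in iota 0 (size s) by rewrite mem_iota add0n ss index_mem.
have /allP/(_ _ iy)/eqP <- := rel _ ix.
by rewrite row_adj_rows ?index_mem // /f !nth_index.
Qed.

(** * From polyhedra to degree sequences *)

Section Planar.
Import Order.TTheory GRing.Theory Num.Theory numFieldNormedType.Exports.
Local Open Scope ring_scope.
Local Open Scope classical_set_scope.

(** Arcs of disjoint edges can only meet in positions of vertices, and such a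
    position would be a common end. *)
Lemma planar_K33_free (R : realType) (G : sgraph) : planar R G -> ~ K33 (@adj G).
Proof.
move=> [pos [arc [ipos harc hend hmeet]]] [A [B [[uA uB] sA sB /allrelP hAB]]].
have x0 : G by case: A sA {uA hAB}.
pose p (i : 'I_3) := nth x0 A i; pose q (j : 'I_3) := nth x0 B j.
have pq i j : adj (p i) (q j) by apply: hAB; apply: mem_nth; rewrite ?sA ?sB.
have pinj i k : i != k -> p i <> p k.
  by move=> ik /eqP; rewrite nth_uniq ?sA //; apply/negP.
have qinj j l : j != l -> q j <> q l.
  by move=> jl /eqP; rewrite nth_uniq ?sB //; apply/negP.
have pnq i j : p i <> q j by move=> E; have := pq i j; rewrite E adj_irrefl.
have /choice[F hF] : forall z : 'I_3 * 'I_3, exists f : R -> R * R,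
    [/\ {within `[0, 1], continuous f}, f 0 = pos (p z.1), f 1 = pos (q z.2) &
        arc (p z.1) (q z.2) = f @` `[0, 1]].
  move=> z; have [[f [cf _ f0 f1 E]] _] := harc _ _ (pq z.1 z.2).
  by exists f.
apply: (@K33_arcs_meet R (pos \o p) (pos \o q) (fun i j => F (i, j))).
- by move=> i j; case: (hF (i, j)).
- by move=> i j; case: (hF (i, j)).
- by move=> i j; case: (hF (i, j)).
move=> i j k l s t ik jl s01 t01; apply/eqP => E.
have [_ _ _ Ef] := hF (i, j); have [_ _ _ Eg] := hF (k, l).
have m1 : arc (p i) (q j) (F (i, j) s) by rewrite Ef; exists s.
have m2 : arc (p k) (q l) (F (i, j) s) by rewrite Eg E; exists t.
have [|||z _ Ez] := hmeet _ _ _ _ (pq i j) (pq k l) _ _ (F (i, j) s).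
- by move=> [/(pinj _ _ ik)].
- by move=> [/pnq].
- by [].
rewrite -Ez in m1 m2.
have [z1|z1] := hend _ _ _ (pq i j) m1; have [z2|z2] := hend _ _ _ (pq k l) m2.
- by apply: (pinj i k ik); rewrite -z1.
- by apply: (pnq i l); rewrite -z1.
- by apply: (pnq k j); rewrite -z1.
by apply: (qinj j l jl); rewrite -z1.
Qed.

End Planar.

(** A path that avoids T cannot leave C. *)
Lemma cut_not_3connected (G : sgraph) : cut (@adj G) -> ~ three_connected G.
Proof.
move=> [T [C [x [y [sT /andP[Cx xT] /andP[Cy yT] closed]]]]] [_ conn].
have := conn [set z in T] x y; rewrite !inE xT yT => /(_ _ isT isT) h.
have /h /connectP[p] : #|[set z in T]| < 3.
  by rewrite ltnS (leq_trans _ sT) // cardsE card_size.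
elim: p x Cx {xT h} => [|z p IH] x Cx /= => [_ E|/andP[/and3P[xz _]]].
  by move: Cy; rewrite E Cx.
rewrite inE => zT pp E; apply: (IH z) => //.
by have := closed x z Cx xz; rewrite (negbTE zT) orbF.
Qed.

Section Main.
Variables (R : realType) (s : seq nat).
Hypothesis forced : forall G : sgraph, realises G s -> polyhedral R G.

Lemma same_degrees_polyhedral (G : sgraph) (e : rel G) : 
  realises G s -> same_degrees (@adj G) e ->
  ~ K33 e /\ ~ cut e.
Proof.
move=> rG [[sym irr] de]; pose H := SGraph sym irr.
have rH : realises H s.
  by rewrite /realises; under [X in perm_eq X _]eq_map => x do rewrite [degree _]de.
have [pH cH] := forced rH; split; first exact: (planar_K33_free pH).
by move=> /(@cut_not_3connected H).
Qed.

Lemma same_degrees_refl (G : sgraph) : same_degrees (@adj G) (@adj G).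
Proof. by split=> //; split; [exact: adj_sym|exact: adj_irrefl]. Qed.

(** The neighbours of a vertex of smaller degree would be a cut. *)
Lemma degree_ge3 (G : sgraph) x : realises G s -> 3 <= deg (@adj G) x.
Proof.
move=> rG; have [_ [n4 _]] := forced rG; have [_] := same_degrees_polyhedral rG (same_degrees_refl G).
rewrite leqNgt => noC; apply/negP => d2; apply: noC.
have [t [ut st tP]] := nbrsP (@adj G) x.
have xt : x \notin t by rewrite -tP adj_irrefl.
have [y] : exists y, y \notin x :: t by apply: fresh; rewrite /= st; apply: leq_trans n4.
rewrite inE negb_or => /andP[yx yt].
exists t, (pred1 x), x, y; split=> //=; rewrite ?st ?eqxx ?yx //.
by move=> u w /eqP-> ; rewrite tP => ->; rewrite orbT.
Qed.

Lemma few_vertices (G : sgraph) : realises G s -> #|G| <= 8.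
Proof.
move=> rG; have [sG _] := same_degrees_refl G; have dge x := degree_ge3 x rG.
have [_ [n4 _]] := forced rG; rewrite leqNgt; apply/negP => n9.
have [[t1 [t2 [t12 d1 d2]]]|no] := pselect (exists t1 t2 : G,
    [/\ t1 != t2, deg (@adj G) t1 = 3 & deg (@adj G) t2 = 3]).
  apply: (@two_cubic G (@adj G) n9 dge _ _ t1 t2) => // [e ge|e ge|].
  - by case: (same_degrees_polyhedral rG ge).
  - by case: (same_degrees_polyhedral rG ge).
  by exists (@adj G); exact: same_degrees_refl.
have [||e [se de kE]] := few_cubic_K33able (@few_cubic_nine G) sG.
- have -> : num_active (@adj G) = #|G| by apply: eq_card => x; rewrite !inE (leq_trans _ (dge x)).
  exact: n9.
- split=> [x _|x y dx dy]; first exact: dge.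
  by apply: contrapT => /eqP xy; apply: no; exists x, y.
by case: (@same_degrees_polyhedral G e rG).
Qed.

Lemma exceptional_order (G : sgraph) : realises G s -> exists L : seq G,
  [/\ uniq L, (forall x, x \in L), [seq deg (@adj G) x | x <- L] \in exceptional &
      perm_eq [seq deg (@adj G) x | x <- L] s /\ sorted geq [seq deg (@adj G) x | x <- L]].
Proof.
move=> rG; have [sG _] := same_degrees_refl G; have dge x := degree_ge3 x rG.
have [_ [n4 _]] := forced rG; have n8 := few_vertices rG.
have [L [uL memL sL srt]] := degree_order (@adj G).
have allL x : x \in L by rewrite memL; apply: leq_trans (dge x).
have outL x : x \notin L -> deg (@adj G) x = 0 by rewrite allL.
have aG : num_active (@adj G) = #|G| by apply: eq_card => x; rewrite !inE (leq_trans _ (dge x)).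
exists L; split=> //; last first.
  split=> //; apply: perm_trans rG; apply: perm_map; apply: uniq_perm; rewrite ?enum_uniq //.
  by move=> x; rewrite allL mem_enum.
set t := map _ _ in srt *; have st : size t = #|G| by rewrite size_map sL aG.
have bt : all (fun d => 3 <= d <= #|G|.-1) t.
  apply/allP => _ /mapP[x _ ->]; rewrite dge andTb.
  have := deg_lt_active sG (leq_trans (isT : 0 < 3) (dge x)); rewrite aG.
  by case: #|G|.
have nG : #|G| \in iota 4 5 by rewrite mem_iota n4 ltnS.
have := seqs_mem srt bt; rewrite st => /(allP (allP small_checked _ nG)).
rewrite (erdos_gallai_nec sG uL outL) /=.
case/or3P => // [/(check_K33_sound uL outL)|/(check_cut_sound uL outL allL)].
  by move=> [e [se de kE]]; case: (@same_degrees_polyhedral G e rG).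
by move=> [e [ge ce]]; case: (same_degrees_polyhedral rG ge).
Qed.

(** Both graphs, ordered by degree, are relabellings of the same list of rows. *)
Lemma realisations_isomorphic (G H : sgraph) : realises G s -> realises H s -> isomorphic H G.
Proof.
move=> rG rH; have [LG [uG aG xG [pG oG]]] := exceptional_order rG.
have [LH [uH aH xH [pH oH]]] := exceptional_order rH.
have E : [seq deg (@adj G) x | x <- LG] = [seq deg (@adj H) x | x <- LH].
  apply: (sorted_eq (leT := geq)) => //.
  - by move=> x y z h1 h2; exact: leq_trans h2 h1.
  - by move=> x y /=; rewrite andbC -eqn_leq => /eqP.
  by apply: perm_trans pG _; rewrite perm_sym.
have sz : size LG = size LH by rewrite -(size_map (deg (@adj G))) E size_map.
have [_ [nG _]] := forced rG; have [_ [nH _]] := forced rH.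
have /card_gt0P[x0 _] : 0 < #|G| by exact: ltn_trans nG.
have /card_gt0P[y0 _] : 0 < #|H| by exact: ltn_trans nH.
have [pi ppi hG] := exceptional_rows x0 (same_degrees_refl G).1 uG aG xG.
have [rho prho hH] := exceptional_rows y0 (same_degrees_refl H).1 uH aH xH.
have mG i : (i \in pi) = (i < size LG) by rewrite (perm_mem ppi) mem_iota.
have mH i : (i \in rho) = (i < size LG) by rewrite (perm_mem prho) mem_iota sz.
have upi : uniq pi by rewrite (perm_uniq ppi) iota_uniq.
have urho : uniq rho by rewrite (perm_uniq prho) iota_uniq.
have spi : size pi = size LG by rewrite (perm_size ppi) size_iota.
have srho : size rho = size LG by rewrite (perm_size prho) size_iota sz.
pose h (x : H) : G := nth x0 LG (index (nth 0 rho (index x LH)) pi).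
have inpi x : nth 0 rho (index x LH) \in pi.
  by rewrite mG -mH mem_nth // srho sz index_mem.
have hidx x : nth 0 pi (index (h x) LG) = nth 0 rho (index x LH).
  by rewrite index_uniq ?nth_index // -spi index_mem.
exists h; last by move=> x y; rewrite hG hH !hidx E.
have injh : injective h.
  move=> x y hxy; have := hidx x; rewrite hxy hidx => /eqP.
  rewrite nth_uniq ?srho ?sz ?index_mem // => /eqP exy.
  by rewrite -(nth_index y0 (aH x)) -exy nth_index.
apply: inj_card_bij => //.
have cL (V : finType) (L : seq V) : uniq L -> (forall x, x \in L) -> #|V| = size L.
  by move=> uL aL; rewrite -(card_uniqP uL); apply: eq_card => x; rewrite aL.
by rewrite (cL G LG) // (cL H LH) // sz.
Qed.

End Main.

Theorem mainTheorem2 (R : realType) (s : seq nat) :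
  forcibly_polyhedral R s -> unigraphic s.
Proof.
move=> [[G rG] forced]; exists G => // H rH.
exact: (realisations_isomorphic forced rG rH).
Qed.
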